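(* Let $(R,\mathfrak m)$ be a Cohen-Macaulay local ring of dimension two with infinite residue field, let $I,J$ be $\mathfrak m$-primary ideals of $R$, and let $(a,b)$ be a joint reduction of $I$ and $J$. (a) Let $r,s\ge0$. Then for all $k\gg0$, $$\begin{aligned}\ell(M^1_{r,s}(a^k,b^k))={}&[e_{(0,1)}-g_1(r)-e_{(1,1)}r+e_{(1,0)}-h_1(s)-e_{(1,1)}s]\,k\\&-e_{(1,1)}rs+[e_{(0,1)}-g_1(r)]s+[e_{(1,0)}-h_1(s)]r\\&-e_2(IJ)+g_2(r)+h_2(s)-\ell(R/I^rJ^s)+\ell\left(\frac{\widetilde{\mathcal F}_{(a,b)}(I^r,J^s)}{I^rJ^s}\right).\end{aligned}$$ In particular, for $k\gg0$, $\ell(M^1_{r,s}(a^k,b^k))$ is a polynomial in $k$ of degree at most one. Assume in addition, for (b) and (c), that $a$ and $b$ are Rees-superficial elements for $I$ and $J$, respectively, and let $k\ge1$. (b) For each $r\ge0$ and all $s\gg0$, $\ell(M^1_{r,s}(a^k,b^k))=k^2e_{(1,1)}+k[g_1(r+k)-g_1(r)]$; and for each $s\ge0$ and all $r\gg0$, $\ell(M^1_{r,s}(a^k,b^k))=k^2e_{(1,1)}+k[h_1(s+k)-h_1(s)]$. In particular, if $r\ge0$ and $s\gg0$ (resp. $s\ge0$ and $r\gg0$), then $\ell(M^1_{r,s}(a^k,b^k))$ is independent of $s$ (resp. $r$) and of the joint reduction $(a,b)$. (c) For all $r,s\gg0$, $$\sum_{i=0}^{r-1}\ell(M^1_{ik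,s}(a^k,b^k))=k[e_{(0,1)}-e_1(J)]\quad\text{and}\quad\sum_{i=0}^{s-1}\ell(M^1_{r,ik}(a^k,b^k))=k[e_{(1,0)}-e_1(I)].$$
   Context: $\ell$ denotes length of $R$-modules, and $I^0=J^0=R$. A pair $(a,b)$ is a joint reduction of $I$ and $J$ if $a\in I$, $b\in J$ and $I^{r+1}J^{s+1}=aI^rJ^{s+1}+bI^{r+1}J^s$ for all large $r,s$. The element $a\in I$ is Rees-superficial for $I$ if $(a)\cap I^rJ^s=aI^{r-1}J^s$ for $r\gg0$ and all $s\ge0$; $b\in J$ is Rees-superficial for $J$ if $(b)\cap I^rJ^s=bI^rJ^{s-1}$ for $s\gg0$ and all $r\ge0$. For $r,s\ge 0$, $k\ge1$: $M^1_{r,s}(a^k,b^k):=\dfrac{I^{r+k}J^{s+k}}{a^kI^rJ^{s+k}+b^kI^{r+k}J^s}$, and $\widetilde{\mathcal F}_{(a,b)}(I^r,J^s):=\bigcup_{k\ge1}\big((I^{r+k}J^s:a^k)\cap(I^rJ^{s+k}:b^k)\big)$. Hilbert coefficients: for an $\mathfrak m$-primary ideal $K$, $\ell(R/K^n)=e_0(K)\binom{n+1}{2}-e_1(K)n+e_2(K)$ for $n\gg0$. Bigraded Hilbert coefficients $e_{(i,j)}$ of $\{I^rJ^s\}$: $\ell(R/I^rJ^s)=\sum_{i+j\le 2}(-1)^{i+j}e_{(i,j)}\binom{r+i-1}{i}\binom{s+j-1}{j}$ for all $r,s\gg0$. For each fixed $r\ge0$ there are integers $g_1(r),g_2(r)$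 with $\ell(R/I^rJ^s)=e_0(J)\binom{s+1}{2}-g_1(r)s+g_2(r)$ for all $s\gg0$; for each fixed $s\ge0$ there are integers $h_1(s),h_2(s)$ with $\ell(R/I^rJ^s)=e_0(I)\binom{r+1}{2}-h_1(s)r+h_2(s)$ for all $r\gg0$. *)

(* Defs.v *)
From HB Require Import structures.
From mathcomp Require Import all_boot all_order all_algebra.
From mathcomp Require Export boolp classical_sets cardinality filter.

Set Implicit Arguments.
Unset Strict Implicit.
Unset Printing Implicit Defensive.

Import GRing.Theory.
Local Open Scope ring_scope.
Local Open Scope classical_set_scope.

Section Ideals.
Variable R : comNzRingType.
Implicit Types (A B I J K P m S : set R) (a b x y : R).

(* The unit ideal [set: R] is an ideal. *)
Definition ideal I : Prop :=
  [/\ I 0, forall x y, I x -> I y -> I (x + y) & forall a x, I x -> I (a * x)].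

Definition ideal_gen S : set R := smallest ideal S.

Definition ideal_add I J : set R :=
  [set z | exists x y, [/\ I x, J y & z = x + y]].

Definition ideal_mul I J : set R :=
  ideal_gen [set z | exists x y, [/\ I x, J y & z = x * y]].

Definition ideal_pow I n : set R := iter n (ideal_mul I) [set: R].

Definition elt_mul a I : set R := [set a * x | x in I].

Definition principal a : set R := elt_mul a [set: R].

Definition colon I a : set R := [set x | I (a * x)].

Definition radical I : set R := [set x | exists n, I (x ^+ n)].

Definition prime_ideal P : Prop :=
  [/\ ideal P, P <> [set: R] & forall x y, P (x * y) -> P x \/ P y].

Definition primary_ideal I : Prop :=
  [/\ ideal I, I <> [set: R]
    & forall x y, I (x * y) -> I x \/ exists n, I (y ^+ n)].

Definition is_primary_to m I : Prop := primary_ideal I /\ radical I = m.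

Definition maximal_ideal m : Prop :=
  [/\ ideal m, m <> [set: R]
    & forall I, ideal I -> m `<=` I -> I = m \/ I = [set: R]].

Definition local_ring m : Prop :=
  maximal_ideal m /\ forall m', maximal_ideal m' -> m' = m.

Definition noetherian : Prop :=
  forall I, ideal I -> exists s : seq R, I = ideal_gen [set x | x \in s].

Definition chain (T : set (set R)) (C : nat -> set R) (n : nat) : Prop :=
  (forall i, (i <= n)%N -> T (C i)) /\
  (forall i, (i < n)%N -> C i `<` C i.+1).

Definition krull_dim_is (d : nat) : Prop :=
  (exists C, chain prime_ideal C d) /\
  (forall C n, chain prime_ideal C n -> (n <= d)%N).

Definition regular_sequence (s : seq R) : Prop :=
  ideal_gen [set x | x \in s] <> [set: R] /\
  forall i, (i < size s)%N -> forall y,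
    ideal_gen [set x | x \in take i s] (s`_i * y) ->
    ideal_gen [set x | x \in take i s] y.

Definition regular_sequence_in m (s : seq R) : Prop :=
  regular_sequence s /\ forall x, x \in s -> m x.

Definition depth_is m (d : nat) : Prop :=
  (exists2 s, regular_sequence_in m s & size s = d) /\
  (forall s, regular_sequence_in m s -> (size s <= d)%N).

Definition cohen_macaulay_local m : Prop :=
  [/\ noetherian, local_ring m & exists2 d, krull_dim_is d & depth_is m d].

(* The residue field R/m, as the set of cosets of m. *)
Definition residue_field m : set (set R) :=
  range (fun x => [set y | m (y - x)]).

(* Subquot A B stands for the R-module A/B, where B `<=` A are ideals. Its
   submodules are the N/B with N an ideal such that B `<=` N `<=` A, so its
   length is the largest length of a chain of ideals from B to A. *)
Record subquot := Subquot { sq_num : set R; sq_den : set R }.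

Definition chain_between (Q : subquot) (n : nat) : Prop :=
  exists C, [/\ chain ideal C n, C 0%N = sq_den Q & C n = sq_num Q].

Definition has_length (Q : subquot) (n : nat) : Prop :=
  chain_between Q n /\ forall k, chain_between Q k -> (k <= n)%N.

Definition finite_length (Q : subquot) : Prop := exists n, has_length Q n.

(* Only meaningful when finite_length Q holds (junk value 0 otherwise). *)
Definition len (Q : subquot) : nat := xget 0%N (has_length Q).

Definition colength I : nat := len (Subquot [set: R] I).

Definition bipow I J r s : set R := ideal_mul (ideal_pow I r) (ideal_pow J s).

Definition joint_reduction I J a b : Prop :=
  [/\ I a, J b &
    \forall r \near \oo & s \near \oo,
      bipow I J r.+1 s.+1 =
      ideal_add (elt_mul a (bipow I J r s.+1)) (elt_mul b (bipow I J r.+1 s))].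

Definition rees_superficial_l I J a : Prop :=
  I a /\ \forall r \near \oo, forall s,
    principal a `&` bipow I J r s = elt_mul a (bipow I J r.-1 s).

Definition rees_superficial_r I J b : Prop :=
  J b /\ \forall s \near \oo, forall r,
    principal b `&` bipow I J r s = elt_mul b (bipow I J r s.-1).

(* M1 I J a b k r s is M^1_{r,s}(a^k, b^k). *)
Definition M1 I J a b (k r s : nat) : subquot :=
  Subquot (bipow I J (r + k) (s + k))
    (ideal_add (elt_mul (a ^+ k) (bipow I J r (s + k)))
               (elt_mul (b ^+ k) (bipow I J (r + k) s))).

Definition Ftilde I J a b (r s : nat) : set R :=
  \bigcup_(k in [set k | (1 <= k)%N])
    (colon (bipow I J (r + k) s) (a ^+ k) `&`
     colon (bipow I J r (s + k)) (b ^+ k)).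

Definition hilbert_coefficients K (e : nat -> int) : Prop :=
  \forall n \near \oo,
    (colength (ideal_pow K n))%:Z
    = e 0%N * ('C(n.+1, 2))%:Z - e 1%N * n%:Z + e 2%N.

Definition bihilbert_coefficients I J (e : nat -> nat -> int) : Prop :=
  \forall r \near \oo & s \near \oo,
    (colength (bipow I J r s))%:Z
    = \sum_(i < 3) \sum_(j < 3 | (i + j <= 2)%N)
        (-1) ^+ (i + j) * e i j
        * ('C(r + i - 1, i))%:Z * ('C(s + j - 1, j))%:Z.

(* The coefficients of s |-> l(R/I^r J^s) for each fixed r, where e0J = e_0(J);
   the thresholds for s depend on r. *)
Definition row_coefficients I J (e0J : int) (g1 g2 : nat -> int) : Prop :=
  forall r, \forall s \near \oo,
    (colength (bipow I J r s))%:Z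
    = e0J * ('C(s.+1, 2))%:Z - g1 r * s%:Z + g2 r.

Definition col_coefficients I J (e0I : int) (h1 h2 : nat -> int) : Prop :=
  forall s, \forall r \near \oo,
    (colength (bipow I J r s))%:Z
    = e0I * ('C(r.+1, 2))%:Z - h1 s * r%:Z + h2 s.

End Ideals.

Arguments noetherian : clear implicits.
Arguments krull_dim_is : clear implicits.

(* Main.v *)
(* Write p = a^k, q = b^k, A = I^r J^{s+k}, B = I^{r+k} J^s. Since (a, b) is
   m-primary and R is Cohen-Macaulay of dimension two, the Koszul complex of
   (p, q) is exact in the middle, and filtering (p, q) / (pA + qB) by pA + (q)
   gives
     l(R/(pA + qB)) = l(R/(p, q)) + l(R/A) + l(R/B) - l(R/((A : q) /\ (B : p))),
   where l(R/(p, q)) = k^2 l(R/(a, b)). For k >> 0 the last ideal is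
   Ftilde(I^r, J^s). For r, s >> 0 the joint reduction property gives
   M^1_{r,s}(a^k, b^k) = 0 for all k, so k^2 (e_{(1,1)} - l(R/(a, b))) is
   bounded by l(R/I^r J^s) and hence l(R/(a, b)) = e_{(1,1)}. This yields (a).
   If a and b are Rees-superficial, then they are nonzerodivisors and the last
   ideal equals I^r J^s as soon as r or s is large, which yields (b); the sums
   in (c) telescope because g_1(r) = e_{(0,1)} - e_{(1,1)} r for r >> 0. *)
Require Import Defs.
From mathcomp Require Import all_boot all_order all_algebra.
From mathcomp Require Import ring zify.
From mathcomp Require Import boolp classical_sets cardinality filter.

Set Implicit Arguments.
Unset Strict Implicit.
Unset Printing Implicit Defensive.

Import GRing.Theory.
Local Open Scope ring_scope.
Local Open Scope classical_set_scope.

(** * Ideals *)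

Section Ideals.
Variable R : comNzRingType.
Implicit Types (A B I J K L M N S X Y : set R) (a b c p q x y z : R).

Lemma ideal0 I : ideal I -> I 0. Proof. by case. Qed.

Lemma idealD I x y : ideal I -> I x -> I y -> I (x + y).
Proof. by case=> _ h _; exact: h. Qed.

Lemma idealMl I a x : ideal I -> I x -> I (a * x).
Proof. by case=> _ _ h; exact: h. Qed.

Lemma idealMr I a x : ideal I -> I x -> I (x * a).
Proof. by move=> hI Ix; rewrite mulrC; exact: idealMl. Qed.

Lemma idealN I x : ideal I -> I x -> I (- x).
Proof. by move=> hI Ix; rewrite -mulN1r; exact: idealMl. Qed.

Lemma idealB I x y : ideal I -> I x -> I y -> I (x - y).
Proof. by move=> hI Ix Iy; apply: idealD => //; exact: idealN. Qed.

Lemma ideal_gen_ideal S : ideal (ideal_gen S).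
Proof.
split=> [A [hA _]|x y hx hy A [hA SA]|a x hx A [hA SA]].
- exact: ideal0.
- by apply: idealD => //; [apply: hx|apply: hy].
- by apply: idealMl => //; apply: hx.
Qed.

Lemma ideal_gen_sub S : S `<=` ideal_gen S.
Proof. exact: sub_gen_smallest. Qed.

Lemma ideal_gen_min S A : ideal A -> S `<=` A -> ideal_gen S `<=` A.
Proof. by move=> hA SA; apply: smallest_sub. Qed.

Lemma idealT : ideal [set: R]. Proof. by split. Qed.

Lemma idealI A B : ideal A -> ideal B -> ideal (A `&` B).
Proof.
move=> hA hB; split=> [|x y [? ?] [? ?]|c x [? ?]].
- by split; exact: ideal0.
- by split; exact: idealD.
- by split; exact: idealMl.
Qed.

Lemma ideal_addP A B : ideal A -> ideal B -> ideal (ideal_add A B).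
Proof.
move=> hA hB.
split=> [|x y [a [b [? ? ->]]] [a' [b' [? ? ->]]]|c x [a [b [? ? ->]]]].
- by exists 0, 0; split; [exact: ideal0|exact: ideal0|rewrite addr0].
- by exists (a + a'), (b + b'); split; [exact: idealD|exact: idealD|ring].
- by exists (c * a), (c * b); split; [exact: idealMl|exact: idealMl|ring].
Qed.

Lemma ideal_addl A B : ideal B -> A `<=` ideal_add A B.
Proof.
by move=> hB x Ax; exists x, 0; rewrite addr0; split=> //; exact: ideal0.
Qed.

Lemma ideal_addr A B : ideal A -> B `<=` ideal_add A B.
Proof.
by move=> hA x Bx; exists 0, x; rewrite add0r; split=> //; exact: ideal0.
Qed.

Lemma ideal_add_sub A B K :
  ideal K -> A `<=` K -> B `<=` K -> ideal_add A B `<=` K.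
Proof. by move=> hK AK BK x [y [z [? ? ->]]]; apply: idealD; auto. Qed.

Lemma ideal_addC A B : ideal_add A B = ideal_add B A.
Proof.
by apply/seteqP; split=> x [y [z [? ? ->]]]; exists z, y; rewrite addrC.
Qed.

Lemma elt_mulP c A : ideal A -> ideal (elt_mul c A).
Proof.
move=> hA; split=> [|x y [a ? <-] [a' ? <-]|d x [a ? <-]].
- by exists 0; [exact: ideal0|rewrite mulr0].
- by exists (a + a'); [exact: idealD|ring].
- by exists (d * a); [exact: idealMl|ring].
Qed.

Lemma principalP c : ideal (principal c).
Proof. by apply: elt_mulP; exact: idealT. Qed.

Lemma colonP A c : ideal A -> ideal (colon A c).
Proof.
move=> hA; split=> [|x y hx hy|d x hx]; rewrite /colon /=.
- by rewrite mulr0; exact: ideal0.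
- by rewrite mulrDr; exact: idealD.
- by rewrite mulrCA; exact: idealMl.
Qed.

Lemma colon_sub A c : ideal A -> A `<=` colon A c.
Proof. by move=> hA x Ax; exact: idealMl. Qed.

Lemma principal_id c : principal c c.
Proof. by exists 1; rewrite ?mulr1. Qed.

End Ideals.

(** * Length of a subquotient *)

Section Length.
Variable R : comNzRingType.
Implicit Types (A B M N X Y : set R) (c : R).

Lemma chain_between_sub A B k : chain_between (Subquot A B) k ->
  [/\ ideal A, ideal B & B `<=` A].
Proof.
case=> X [[Xid Xlt] /= <- <-]; split; [exact: Xid|exact: Xid|].
suff h i : (i <= k)%N -> X 0%N `<=` X i by exact: h.
elim: i => [|i IH] ik; first exact: subset_refl.
apply: (subset_trans (IH (ltnW ik))).
by have [] := Xlt i ik.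
Qed.

(** Initial and final segments of a chain are themselves chains, so [chain_between_sub] applies to
    each. *)
Lemma chain_bounds (X_ : nat -> set R) k i :
  chain (@ideal R) X_ k -> (i <= k)%N ->
  X_ 0%N `<=` X_ i /\ X_ i `<=` X_ k.
Proof.
move=> [Xid Xlt] ik; split.
- suff [] : [/\ ideal (X_ i), ideal (X_ 0%N) & X_ 0%N `<=` X_ i] by [].
  apply: (@chain_between_sub _ _ i); exists X_; split=> //.
  by split=> j ji; [apply: Xid|apply: Xlt]; lia.
- suff [] : [/\ ideal (X_ k), ideal (X_ i) & X_ i `<=` X_ k] by [].
  apply: (@chain_between_sub _ _ (k - i)).
  exists (fun j => X_ (i + j)%N); rewrite addn0 subnKC //; split=> //.
  by split=> j ji; rewrite ?addnS; [apply: Xid|apply: Xlt]; lia.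
Qed.

Lemma chain_between0 A : ideal A -> chain_between (Subquot A A) 0.
Proof. by move=> hA; exists (fun=> A). Qed.

Lemma chain_between1 A B : ideal A -> ideal B -> B `<` A ->
  chain_between (Subquot A B) 1.
Proof.
move=> hA hB AB; exists (fun i => if i is 0%N then B else A).
by split=> //; split=> [[|i]|[|i]].
Qed.

Lemma chain_between_cat A B M k l :
  chain_between (Subquot A M) k -> chain_between (Subquot M B) l ->
  chain_between (Subquot A B) (k + l).
Proof.
case=> X [[Xid Xlt] /= X0 Xk] [Y [[Yid Ylt] /= Y0 Yl]].
exists (fun i => if (i <= l)%N then Y i else X (i - l)%N).
split=> /=; last first; [|by rewrite Y0|].
(* The first branch has [k + l <= l], so [k = 0]: then [M = A], and the last index still falls on
   the [Y] side. *)
- case: ifP; last by rewrite addnK.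
  case: k Xk {Xid Xlt} => [|k] Xk ?; last by lia.
  by rewrite -Xk X0 -Yl.
- split=> i ik.
  + by case: ifP => il; [exact: Yid|apply: Xid; lia].
  + case: (ltngtP i l) => il.
    * exact: Ylt.
    * by rewrite subSn; [apply: Xlt; lia|exact: ltnW].
    * by rewrite il subSnn Yl -X0; apply: Xlt; lia.
Qed.

Lemma chain_between_ex A B : ideal A -> ideal B -> B `<=` A ->
  exists k, chain_between (Subquot A B) k.
Proof.
move=> hA hB BA; have [AB|nAB] := pselect (A `<=` B).
  have -> : B = A by apply/seteqP.
  by exists 0%N; exact: chain_between0.
by exists 1%N; exact: chain_between1.
Qed.

(** The set of chain lengths is bounded, and nonempty by [chain_between_ex], so it has a maximum. *)
Lemma finite_length_bound A B n : ideal A -> ideal B -> B `<=` A ->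
  (forall k, chain_between (Subquot A B) k -> (k <= n)%N) ->
  finite_length (Subquot A B).
Proof.
move=> hA hB BA hn.
have [k hk] := chain_between_ex hA hB BA.
have ex : exists k, `[< chain_between (Subquot A B) k >].
  by exists k; apply/asboolP.
have bd j : `[< chain_between (Subquot A B) j >] -> (j <= n)%N.
  by move/asboolP; exact: hn.
case: (ex_maxnP ex bd) => l /asboolP hl lmax.
by exists l; split=> // j hj; apply: lmax; apply/asboolP.
Qed.

Lemma lenP Q : finite_length Q -> @has_length R Q (len Q).
Proof. exact: xgetPex. Qed.

Lemma has_length_uniq Q k l : @has_length R Q k -> has_length Q l -> k = l.
Proof.
by move=> [hk km] [hl lm]; apply/eqP; rewrite eqn_leq lm // km.
Qed.

Lemma has_lengthE Q k : @has_length R Q k -> len Q = k.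
Proof. by move=> h; apply: has_length_uniq (h); apply: lenP; exists k. Qed.

Lemma chain_len Q k : finite_length Q -> chain_between Q k -> (k <= @len R Q)%N.
Proof. by move=> /lenP [_ h]; exact: h. Qed.

Lemma finite_length_sub A B : finite_length (Subquot A B) ->
  [/\ ideal A, ideal B & B `<=` A].
Proof. by case=> n [/chain_between_sub]. Qed.

(** A chain from [B'] to [A'] extends at both ends to a chain from [B] to [A], which bounds its
    length. *)
Lemma finite_lengthS A B A' B' : finite_length (Subquot A B) ->
  ideal A' -> ideal B' -> B `<=` B' -> B' `<=` A' -> A' `<=` A ->
  finite_length (Subquot A' B').
Proof.
move=> fAB hA' hB' BB' BA' AA'; have [hA hB BA] := finite_length_sub fAB.
apply: (@finite_length_bound _ _ (len (Subquot A B))) => // k hk.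
have [u hu] := chain_between_ex hA hA' AA'.
have [v hv] := chain_between_ex hB' hB BB'.
have := chain_len fAB (chain_between_cat (chain_between_cat hu hk) hv); lia.
Qed.

Lemma len_superadd A M B : finite_length (Subquot A B) ->
  ideal M -> B `<=` M -> M `<=` A ->
  (len (Subquot A M) + len (Subquot M B) <= len (Subquot A B))%N.
Proof.
move=> f hM BM MA; have [hA hB BA] := finite_length_sub f.
apply: chain_len => //; apply: (@chain_between_cat _ _ M).
  by have [] := lenP (finite_lengthS f hA hM BM MA (@subset_refl _ A)).
by have [] := lenP (finite_lengthS f hM hB (@subset_refl _ B) BM MA).
Qed.

Lemma len_gt0 A B : finite_length (Subquot A B) -> B `<` A ->
  (0 < len (Subquot A B))%N.
Proof.
move=> f BA; have [hA hB _] := finite_length_sub f.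
exact: chain_len f (chain_between1 hA hB BA).
Qed.

Lemma len_mono A M B : finite_length (Subquot A B) ->
  ideal M -> B `<=` M -> M `<=` A ->
  (len (Subquot M B) <= len (Subquot A B))%N.
Proof. by move=> f hM BM MA; have := len_superadd f hM BM MA; lia. Qed.

Lemma len_ltn A M B : finite_length (Subquot A B) ->
  ideal M -> B `<=` M -> M `<` A ->
  (len (Subquot M B) < len (Subquot A B))%N.
Proof.
move=> f hM BM MA; have MA' := properW MA.
have [hA hB _] := finite_length_sub f.
have := len_gt0 (finite_lengthS f hA hM BM MA' (@subset_refl _ A)) MA.
by have := len_superadd f hM BM MA'; lia.
Qed.

(** This is the modular law: if neither inclusion were strict, any [y] in [Y] would be [x + m] with
    [x] in [X] and [m] in [Y] and [M], hence [m] in [X], and [Y] would lie in [X]. *)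
Lemma modular_strict X Y M : ideal X -> ideal Y -> ideal M -> X `<` Y ->
  X `&` M `<` Y `&` M \/ ideal_add X M `<` ideal_add Y M.
Proof.
move=> hX hY hM [XY nYX]; have [YX|nI] := pselect (Y `&` M `<=` X `&` M).
  right; split=> [z [x [y [Xx My ->]]]|sub].
    by exists x, y; split=> //; exact: XY.
  apply: nYX => y Yy; have [x [m [Xx Mm e]]] := sub y (ideal_addl hM Yy).
  have Ym : Y m.
    have -> : m = y - x by rewrite e; ring.
    by apply: idealB => //; exact: XY.
  by rewrite e; apply: idealD => //; have [] := YX m (conj Ym Mm).
by left; split=> // z [Xz Mz]; split=> //; exact: XY.
Qed.

(* Along a chain of ideals X_i from B to A, the quantity
   len ((X_i /\ M)/B) + len ((X_i + M)/M) strictly increases. *)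
Lemma has_lengthD A M B :
  finite_length (Subquot A M) -> finite_length (Subquot M B) ->
  has_length (Subquot A B) (len (Subquot A M) + len (Subquot M B)).
Proof.
move=> fA fM; have [hA hM MA] := finite_length_sub fA.
have [_ hB BM] := finite_length_sub fM.
split.
  by apply: (@chain_between_cat _ _ M); [have [] := lenP fA|have [] := lenP fM].
move=> k /[dup] /chain_between_sub [_ _ BA] [X [[Xid Xlt] /= X0 Xk]].
pose phi i := (len (Subquot (ideal_add (X i) M) M)
               + len (Subquot (X i `&` M) B))%N.
have BX i : (i <= k)%N -> B `<=` X i.
  by move=> ik; have [] := chain_bounds (conj Xid Xlt) ik; rewrite X0.
have XA i : (i <= k)%N -> X i `<=` A.
  by move=> ik; have [] := chain_bounds (conj Xid Xlt) ik; rewrite Xk.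
have fadd i : (i <= k)%N -> finite_length (Subquot (ideal_add (X i) M) M).
  move=> ik; apply: (finite_lengthS fA) => //.
  - by apply: ideal_addP => //; exact: Xid.
  - by apply: ideal_addr; exact: Xid.
  - by apply: ideal_add_sub => //; exact: XA.
have fcap i : (i <= k)%N -> finite_length (Subquot (X i `&` M) B).
  move=> ik; apply: (finite_lengthS fM) => //.
  - by apply: idealI => //; exact: Xid.
  - by move=> x Bx; split; [exact: (BX i ik)|exact: BM].
have step i : (i < k)%N -> (phi i < phi i.+1)%N.
  move=> ik; have ik' := ltnW ik.
  have hXi := Xid i ik'; have hXi1 := Xid _ ik; have lt := Xlt i ik.
  have le := properW lt.
  have hcap := idealI hXi hM; have hadd := ideal_addP hXi hM.
  have Bcap : B `<=` X i `&` M.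
    by move=> x Bx; split; [exact: (BX i ik')|exact: BM].
  have Madd := @ideal_addr _ (X i) M hXi.
  have capS : X i `&` M `<=` X i.+1 `&` M by move=> x [? ?]; split; auto.
  have addS : ideal_add (X i) M `<=` ideal_add (X i.+1) M.
    by move=> _ [x [y [? ? ->]]]; exists x, y; split; auto.
  have l1 := len_mono (fadd _ ik) hadd Madd addS.
  have l2 := len_mono (fcap _ ik) hcap Bcap capS.
  rewrite /phi; case: (modular_strict hXi hXi1 hM lt) => h.
    by have := len_ltn (fcap _ ik) hcap Bcap h; lia.
  by have := len_ltn (fadd _ ik) hadd Madd h; lia.
(* A strictly increasing sequence of natural numbers dominates its index; at [i = k], where
   [X k = A], [phi] is the claimed length. *)
have bound i : (i <= k)%N -> (i <= phi i)%N.
  elim: i => // i IH ik; have := step i ik; have := IH (ltnW ik); lia.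
have := bound k (leqnn _); rewrite /phi Xk.
have -> : ideal_add A M = A.
  by apply/seteqP; split; [exact: ideal_add_sub|exact: ideal_addl].
by rewrite setIC (setIidl MA).
Qed.

Lemma finite_lengthD A M B :
  finite_length (Subquot A M) -> finite_length (Subquot M B) ->
  finite_length (Subquot A B).
Proof. by move=> fA fM; eexists; exact: has_lengthD fA fM. Qed.

Lemma lenD A M B :
  finite_length (Subquot A M) -> finite_length (Subquot M B) ->
  len (Subquot A B) = (len (Subquot A M) + len (Subquot M B))%N.
Proof. by move=> fA fM; apply: has_lengthE; exact: has_lengthD. Qed.

(* Multiplication by c induces an isomorphism N/(N /\ (B : c)) -> (cN + B)/B. *)
Lemma chain_between_mul N B c k : ideal N -> ideal B ->
  chain_between (Subquot (ideal_add (elt_mul c N) B) B) k <->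
  chain_between (Subquot N (N `&` colon B c)) k.
Proof.
move=> hN hB; have hcN := elt_mulP c hN; have hcol := colonP c hB.
(* Preimage and image under multiplication by [c]. They are monotone and mutually inverse on the two
   intervals of ideals, so they carry strict chains to strict chains. *)
pose f Y := N `&` colon Y c; pose g X := ideal_add (elt_mul c X) B.
have fid Y : ideal Y -> ideal (f Y) by move=> ?; apply/idealI/colonP.
have gid X : ideal X -> ideal (g X) by move=> ?; apply/ideal_addP/hB/elt_mulP.
have fmono Y Y' : Y `<=` Y' -> f Y `<=` f Y'.
  by move=> s x [? ?]; split=> //; exact: s.
have gmono X X' : X `<=` X' -> g X `<=` g X'.
  move=> s _ [_ [y [[x Xx <-] By ->]]]; exists (c * x), y; split=> //.
  by exists x; auto.
have fg X : ideal X -> N `&` colon B c `<=` X -> X `<=` N -> f (g X) = X.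
  move=> hX BX XN; apply/seteqP; split=> [n [Nn]|x Xx].
    rewrite /colon /= => -[_ [y [[x Xx <-] By e]]].
    have -> : n = x + (n - x) by ring.
    apply: idealD => //; apply: BX; split; first by apply: idealB; auto.
    by rewrite /colon /= mulrBr e; have -> : c * x + y - c * x = y by ring.
  split; first exact: XN.
  by exists (c * x), 0; split; [exists x|exact: ideal0|rewrite addr0].
have gf Y : ideal Y -> B `<=` Y -> Y `<=` g N -> g (f Y) = Y.
  move=> hY BY YN; apply/seteqP.
  split=> [_ [_ [y [[x [Nx Yx] <-] By ->]]]|y Yy].
    by apply: idealD; auto.
  have [_ [b [[n Nn <-] Bb e]]] := YN y Yy; exists (c * n), b; split=> //.
  exists n => //; split=> //; rewrite /colon /=.
  have -> : c * n = y - b by rewrite e; ring.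
  by apply: idealB; auto.
have chains A A' l (X : nat -> set R) :
    chain (@ideal R) X l -> X 0%N = A -> X l = A' ->
    forall i, (i <= l)%N -> A `<=` X i /\ X i `<=` A'.
  by move=> hX <- <- i; exact: chain_bounds.
split=> -[X [[Xid Xlt] /= X0 Xk]].
- have bd := chains _ _ _ _ (conj Xid Xlt) X0 Xk.
  exists (f \o X); split=> /=; [|by rewrite X0|].
  + split=> i ik /=; first by apply: fid; exact: Xid.
    have [le nle] := Xlt i ik; split; first exact: fmono.
    move=> s; apply: nle.
    have [b1 b2] := bd _ ik; have [b3 b4] := bd _ (ltnW ik).
    have := gmono _ _ s.
    by rewrite (gf _ (Xid _ ik) b1 b2) (gf _ (Xid _ (ltnW ik)) b3 b4).
  + rewrite Xk; apply/seteqP; split=> [n []//|n Nn]; split=> //.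
    by apply: ideal_addl => //; exists n.
- have bd := chains _ _ _ _ (conj Xid Xlt) X0 Xk.
  exists (g \o X); split=> /=; [| |by rewrite Xk].
  + split=> i ik /=; first by apply: gid; exact: Xid.
    have [le nle] := Xlt i ik; split; first exact: gmono.
    move=> s; apply: nle.
    have [b1 b2] := bd _ ik; have [b3 b4] := bd _ (ltnW ik).
    have := fmono _ _ s.
    by rewrite (fg _ (Xid _ ik) b1 b2) (fg _ (Xid _ (ltnW ik)) b3 b4).
  + rewrite X0; apply/seteqP; split; last first.
      by apply: ideal_addr; apply: elt_mulP; exact: idealI.
    apply: ideal_add_sub => // _ [x [_ Bx] <-]; exact: Bx.
Qed.

Lemma has_length_mul N B c k : ideal N -> ideal B ->
  has_length (Subquot (ideal_add (elt_mul c N) B) B) k <->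
  has_length (Subquot N (N `&` colon B c)) k.
Proof.
move=> hN hB; split=> -[hk km]; split=> [|j hj].
- exact/chain_between_mul.
- by apply/km/chain_between_mul.
- exact/chain_between_mul.
- by apply: km; apply/chain_between_mul.
Qed.

End Length.

(** * Noetherian rings *)

Section Noetherian.
Variable R : comNzRingType.
Hypothesis noethR : noetherian R.
Implicit Types (A B I J K L M N X Y m : set R) (a b c p q x y z : R).

(** The union of the chain is a finitely generated ideal, and its generators all lie in a single
    member. *)
Lemma noetherian_chain (X_ : nat -> set R) :
  (forall i, ideal (X_ i)) -> (forall i, X_ i `<=` X_ i.+1) ->
  exists n, forall k, (n <= k)%N -> X_ k = X_ n.
Proof.
move=> Xid Xle.
have mono i j : (i <= j)%N -> X_ i `<=` X_ j.
  move=> ij; rewrite -(subnKC ij); elim: (j - i)%N => [|d IH].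
    by rewrite addn0.
  by rewrite addnS; apply: (subset_trans IH).
pose U := [set x | exists i, X_ i x].
have Uid : ideal U.
  split=> [|x y [i Xx] [j Xy]|c x [i Xx]].
  - by exists 0%N; exact: ideal0.
  - exists (maxn i j); apply: idealD => //.
      by apply: mono Xx; exact: leq_maxl.
    by apply: mono Xy; exact: leq_maxr.
  - by exists i; exact: idealMl.
have [s Us] := noethR Uid.
have [n sn] : exists n, forall x, x \in s -> X_ n x.
  have : forall x, x \in s -> U x.
    by move=> x xs; rewrite Us; exact: ideal_gen_sub.
  elim: s {Us} => [|y s IH] sU; first by exists 0%N.
  have [x xs|n hn] := IH; first by apply: sU; rewrite inE xs orbT.
  have [i Xy] := sU y (mem_head _ _).
  exists (maxn i n) => x; rewrite inE => /orP[/eqP ->|xs].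
    by apply: mono Xy; exact: leq_maxl.
  by apply: mono (hn x xs); exact: leq_maxr.
exists n => k nk; apply/seteqP; split; last exact: mono.
move=> x Xx; have : U x by exists k.
by rewrite Us; apply: ideal_gen_min.
Qed.

(** Without a maximal member, a choice function would produce a strictly ascending chain in [S]. *)
Lemma noetherian_max (S : set (set R)) A :
  (forall X, S X -> ideal X) -> S A ->
  exists M, S M /\ forall N, S N -> M `<=` N -> N = M.
Proof.
move=> Sid SA; apply: contrapT => nmax.
have next (X : {X | S X}) : exists Y : {Y | S Y}, sval X `<` sval Y.
  case: X => X SX /=; apply: contrapT => nY; apply: nmax; exists X; split=> //.
  move=> N SN XN; apply: contrapT => NX; apply: nY; exists (exist _ N SN).
  by split=> //= NX'; apply: NX; apply/seteqP.
have [f fP] := choice next.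
pose X_ i := sval (iter i f (exist _ A SA)).
have [i||n /(_ n.+1 (leqnSn n)) e] := @noetherian_chain X_.
- by apply: Sid; exact: svalP.
- by move=> i; apply: properW; exact: fP.
- by have [_] := fP (iter n f (exist _ A SA)); rewrite -/(X_ n.+1) e; apply.
Qed.

Lemma ideal_neqT A : ideal A -> ~ A 1 -> A <> [set: R].
Proof. by move=> hA A1 e; apply: A1; rewrite e. Qed.

Lemma ideal_eqT A : ideal A -> A 1 -> A = [set: R].
Proof.
move=> hA A1; apply/seteqP; split=> // x _.
by rewrite -(mulr1 x); exact: idealMl.
Qed.

(** A maximal member among the proper ideals containing [A] is a maximal ideal, hence equal to
    [m]. *)
Lemma proper_sub_maximal m A : local_ring m -> ideal A -> ~ A 1 -> A `<=` m.
Proof.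
move=> [_ lm] hA A1.
have [X []//||M [[hM M1 AM] Mmax]] :=
  @noetherian_max [set X | [/\ ideal X, ~ X 1 & A `<=` X]] A.
  by split.
rewrite -(lm M) //; split=> //; first exact: ideal_neqT.
move=> N hN MN; have [N1|N1] := pselect (N 1); first by right; exact: ideal_eqT.
by left; apply: Mmax => //; split=> //; exact: (subset_trans AM).
Qed.

Lemma maximal1 m : maximal_ideal m -> ~ m 1.
Proof. by move=> [hm mT _] m1; apply: mT; exact: ideal_eqT. Qed.

(** In a chain of length at least two, the term of index 1 would be [m] or the whole ring, against
    strictness at one of its neighbours. *)
Lemma finite_length_maximal m : maximal_ideal m ->
  finite_length (Subquot [set: R] m).
Proof.
move=> mm; have [hm mT mmax] := mm.
apply: (@finite_length_bound _ _ _ 1) => //.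
move=> k [X [hX /= X0 Xk]]; rewrite leqNgt; apply/negP => k1.
have [Xid Xlt] := hX.
have [m1 nm1] := Xlt 0%N (ltnW k1); have [m2 nm2] := Xlt 1%N k1.
rewrite X0 in m1 nm1.
have [e|e] := mmax _ (Xid 1%N (ltnW k1)) m1; first by apply: nm1; rewrite e.
by apply: nm2; rewrite e.
Qed.

(* For K maximal among counterexamples, a maximal proper colon ideal K : z
   equals m, so (K + (z))/K has length one and R/(K + (z)) has finite length. *)
Lemma finite_colength m K : maximal_ideal m -> ideal K -> m `<=` radical K ->
  finite_length (Subquot [set: R] K).
Proof.
move=> mm hK mK; apply: contrapT => nfin; have [hm mT mmax] := mm.
have [X []//||M [[hM mM Mfin] Mmax]] := @noetherian_max
  [set X | [/\ ideal X, m `<=` radical X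
             & ~ finite_length (Subquot [set: R] X)]]
  K.
  by split.
have M1 : ~ M 1.
  move=> M1; apply: Mfin; rewrite (ideal_eqT hM M1).
  apply: (@finite_length_bound _ _ _ 0) => //; try exact: idealT.
  case=> // k [X [[Xid Xlt] /= X0 Xk]].
  by have [_] := Xlt 0%N isT; rewrite X0; case.
have [_ [z Mz <-]||L [[z Mz e] Lmax]] :=
  @noetherian_max [set colon M z | z in ~` M] (colon M 1).
- exact: colonP.
- by exists 1.
subst L.
have em : colon M z = m.
  have hc := colonP z hM.
  have sub : m `<=` colon M z.
    move=> y my; apply: contrapT => nyz.
    (* If [y * z] is not in [M], then by maximality of [M : z] multiplying [z] by [y] never enlarges
       the colon ideal, so no [y ^+ n * z] reaches [M]. But some power of [y] lies in [M]. *)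
    have key n : ~ M (y ^+ n * z) /\ colon M (y ^+ n * z) = colon M z.
      elim: n => [|n [IH1 IH2]]; first by rewrite expr0 mul1r.
      have nM : ~ M (y ^+ n.+1 * z).
        move=> h; apply: nyz; rewrite -IH2 /colon /=.
        by rewrite mulrC mulrA -exprS.
      split=> //; apply: Lmax; first by exists (y ^+ n.+1 * z).
      by move=> x; rewrite /colon /= -mulrA; exact: idealMl.
    have [n Mn] := mM y my; have [h _] := key n; apply: h.
    by rewrite mulrC; exact: idealMl.
  have [//|eT] := mmax _ hc sub.
  by case: Mz; rewrite -[z]mulr1; change (colon M z 1); rewrite eT.
have hN := ideal_addP (principalP z) hM.
have MN := @ideal_addr _ (principal z) M (principalP z).
(* Multiplication by [z] identifies this quotient with [R/(M : z) = R/m]. *)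
have fN : finite_length (Subquot (ideal_add (principal z) M) M).
  have [n hn] := finite_length_maximal mm; exists n.
  by apply/has_length_mul => //; rewrite setTI em.
apply: Mfin; apply: finite_lengthD fN; apply: contrapT => nf.
(* Were [R/(M + (z))] not of finite length, [M + (z)] would be a counterexample above [M], hence
   equal to [M], although [z] is not in [M]. *)
have e : ideal_add (principal z) M = M.
  apply: Mmax => //; split=> //; apply: (subset_trans mM) => x [n Mx].
  by exists n; exact: MN.
apply: Mz; rewrite -e; apply: ideal_addl => //; exact: principal_id.
Qed.

End Noetherian.

(** * Colength and the Koszul complex *)

Section Colength.
Variable R : comNzRingType.
Implicit Types (A B I J K L M N X Y m : set R) (a b c p q x y z : R).

Lemma elt_mul_id c A x : A x -> elt_mul c A (c * x).
Proof. by exists x. Qed.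

Definition cofinite_ideal K := finite_length (Subquot [set: R] K).

Lemma cofinite_idealP K : cofinite_ideal K -> ideal K.
Proof. by case/finite_length_sub. Qed.

Lemma cofinite_idealS K N :
  cofinite_ideal K -> ideal N -> K `<=` N -> cofinite_ideal N.
Proof.
by move=> fK hN KN; apply: (finite_lengthS fK) => //; exact: idealT.
Qed.

Lemma cofinite_finite K N : cofinite_ideal K -> ideal N -> K `<=` N ->
  finite_length (Subquot N K).
Proof.
move=> fK hN KN; apply: (finite_lengthS fK) => //; exact: cofinite_idealP.
Qed.

Lemma colength_len K N : cofinite_ideal K -> ideal N -> K `<=` N ->
  colength K = (colength N + len (Subquot N K))%N.
Proof.
move=> fK hN KN.
by apply: lenD; [exact: cofinite_idealS KN|exact: cofinite_finite].
Qed.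

Lemma colength_setT : colength [set: R] = 0%N.
Proof.
have h := chain_between0 (@idealT R).
apply: has_lengthE; split=> // -[|k] // [X [[Xid Xlt] /= X0 Xk]].
by have [_] := Xlt 0%N isT; rewrite X0; case.
Qed.

(** Both sides are sums of colengths that differ from [l(R/(cN + B)) + l(R/N)] by the length of
    [(cN + B)/B], equal to that of [N/(N /\ (B : c))]. The additive form avoids subtraction in
    [nat]. *)
Lemma colength_mul N B c : ideal N -> cofinite_ideal N -> cofinite_ideal B ->
  (colength B + colength N =
   colength (ideal_add (elt_mul c N) B) + colength (N `&` colon B c))%N.
Proof.
move=> hN fN fB; have hB := cofinite_idealP fB.
have hs := ideal_addP (elt_mulP c hN) hB.
have sub : B `<=` ideal_add (elt_mul c N) B.
  by apply: ideal_addr; exact: elt_mulP.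
have hc := idealI hN (colonP c hB).
have [n hn] := cofinite_finite fB hs sub.
have hn' := (has_length_mul c n hN hB).1 hn.
have fc : cofinite_ideal (N `&` colon B c).
  by apply: finite_lengthD fN _; exists n.
rewrite (colength_len fB hs sub) (colength_len fc hN (@subIsetl _ _ _)).
by rewrite (has_lengthE hn) (has_lengthE hn'); lia.
Qed.

(** Vanishing of the first Koszul homology of [(p, q)], stated without building the complex. *)
Definition koszul_exact p q :=
  forall u v, p * u + q * v = 0 -> exists w, u = q * w /\ v = - (p * w).

Lemma koszul_exactC p q : koszul_exact p q -> koszul_exact q p.
Proof.
move=> h u v e; have [|w [-> ->]] := h v u; first by rewrite addrC.
by exists (- w); split; ring.
Qed.

(* With x = s p + t q, a relation p u + q v = 0 gives x (u, v) = w (q, - p) for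
   w = t u - s v; since w p and w q lie in (x), so does w y, hence w. *)
Lemma koszul_exact_regular x y p q :
  (forall z, x * z = 0 -> z = 0) ->
  (forall z, principal x (y * z) -> principal x z) ->
  ideal_add (principal p) (principal q) x ->
  ideal_add (principal p) (principal q) y ->
  koszul_exact p q.
Proof.
move=> xreg yreg [_ [_ [[s _ <-] [t _ <-] ex]]].
move=> [_ [_ [[s' _ <-] [t' _ <-] ey]]] u v e.
have eu : x * u = q * (t * u - s * v).
  have -> : x * u = q * (t * u - s * v) + s * (p * u + q * v).
    by rewrite ex; ring.
  by rewrite e; ring.
have ev : x * v = - (p * (t * u - s * v)).
  have -> : x * v = - (p * (t * u - s * v)) + t * (p * u + q * v).
    by rewrite ex; ring.
  by rewrite e; ring.
have [w _ ew] : principal x (t * u - s * v).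
  apply: yreg; exists (t' * u - s' * v) => //.
  have -> : x * (t' * u - s' * v) = t' * (x * u) - s' * (x * v) by ring.
  by rewrite eu ev ey; ring.
exists w; split; apply/eqP; rewrite -subr_eq0; apply/eqP; apply: xreg.
  by rewrite mulrBr eu -ew; ring.
by rewrite mulrBr ev -ew; ring.
Qed.

(** With [D = pA + qB] and [D1 = pA + (q)], exactness gives [D1 : p = A + (q)] and
    [D : q = p(A : q) + B]. Each colon ideal enters through [colength_mul]. *)
Lemma colength_koszul p q A B : koszul_exact p q ->
  cofinite_ideal A -> cofinite_ideal B ->
  cofinite_ideal (ideal_add (elt_mul p A) (elt_mul q B)) ->
  (colength (ideal_add (elt_mul p A) (elt_mul q B))
   + colength (colon A q `&` colon B p) =
   colength (ideal_add (principal p) (principal q))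
   + colength A + colength B)%N.
Proof.
move=> kos fA fB; set D := ideal_add _ _ => fD.
have hT := @idealT R.
have hA := cofinite_idealP fA; have hB := cofinite_idealP fB.
have hpA := elt_mulP p hA; have hqB := elt_mulP q hB.
have hq := principalP q; have hp := principalP p.
have eltP c X : elt_mul c X `<=` principal c.
  by move=> _ [x _ <-]; exists x.
have hD := cofinite_idealP fD.
have fT := cofinite_idealS fA hT (@subsetT _ A).
have fAq := cofinite_idealS fA (colonP q hA) (colon_sub q hA).
pose D1 := ideal_add (elt_mul p A) (principal q).
have hD1 : ideal D1 by exact: ideal_addP.
have fD1 : cofinite_ideal D1.
  apply: (cofinite_idealS fD hD1); apply: ideal_add_sub => //.
    exact: ideal_addl.
  by apply: (subset_trans (@eltP q B)); exact: ideal_addr.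
have := colength_mul p hT fT fD1; rewrite colength_setT setTI addn0.
have -> : ideal_add (elt_mul p [set: R]) D1 =
          ideal_add (principal p) (principal q).
  apply/seteqP; split; apply: ideal_add_sub; try exact: ideal_addP.
  - exact: ideal_addl.
  - apply: ideal_add_sub; [exact: ideal_addP| |exact: ideal_addr].
    by apply: (subset_trans (@eltP p A)); exact: ideal_addl.
  - exact: ideal_addl.
  - by apply: (@subset_trans _ D1); exact: ideal_addr.
have -> : colon D1 p = ideal_add A (principal q).
  apply/seteqP; split.
    move=> x; rewrite /colon /= => -[_ [_ [[y Ay <-] [z _ <-] e]]].
    have [|w [ew _]] := kos (x - y) (- z); first by rewrite mulrBr e; ring.
    exists y, (q * w); split=> //; first by exists w.
    by rewrite -ew; ring.
  apply: ideal_add_sub; first exact: colonP.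
    move=> x Ax; apply: ideal_addl => //; exact: elt_mul_id.
  by apply: (@subset_trans _ D1); [exact: ideal_addr|exact: colon_sub].
have := colength_mul q hT fT fD; rewrite colength_setT setTI addn0.
have -> : ideal_add (elt_mul q [set: R]) D = D1.
  apply/seteqP; split; apply: ideal_add_sub; try exact: ideal_addP.
  - exact: ideal_addr.
  - apply: ideal_add_sub; [exact: ideal_addP|exact: ideal_addl|].
    by apply: (subset_trans (@eltP q B)); exact: ideal_addr.
  - by apply: (@subset_trans _ D); [exact: ideal_addl|exact: ideal_addr].
  - exact: ideal_addl.
have -> : colon D q = ideal_add (elt_mul p (colon A q)) B.
  apply/seteqP; split.
    move=> x; rewrite /colon /= => -[_ [_ [[y Ay <-] [z Bz <-] e]]].
    have [|w [ew e']] := kos (- y) (x - z); first by rewrite mulrBr e; ring.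
    exists (- (p * w)), z; split=> //; last by rewrite -e'; ring.
    exists (- w); last by ring.
    rewrite /colon /= mulrN -ew opprK //.
  apply: ideal_add_sub; first exact: colonP.
    move=> _ [x Ax <-]; rewrite /colon /= mulrCA; apply: ideal_addl => //.
    exact: elt_mul_id.
  by move=> x Bx; apply: ideal_addr => //; exact: elt_mul_id.
(* The last two instances express [l(R/(A + (q)))] and [l(R/(p(A : q) + B))]; the colength of
   [A : q] occurs in both and cancels. *)
have := colength_mul q hT fT fA; rewrite colength_setT setTI addn0.
rewrite [ideal_add _ A]ideal_addC -/(principal q).
have := colength_mul p (colonP q hA) fAq fB.
lia.
Qed.

(** Induction through [(p ^+ k.+1, q) <= (p ^+ k, q)]: the quotient is
    [R/((p ^+ k.+1, q) : p ^+ k)], and by exactness this colon ideal is [(p, q)]. *)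
Lemma colength_principal_powl p q k :
  (forall i, koszul_exact (p ^+ i) q) ->
  (forall i, cofinite_ideal (ideal_add (principal (p ^+ i)) (principal q))) ->
  colength (ideal_add (principal (p ^+ k)) (principal q)) =
  (k * colength (ideal_add (principal p) (principal q)))%N.
Proof.
move=> kos fin; have hT := @idealT R; have hp := @principalP R.
have hpT c : ideal (elt_mul c [set: R]) by exact: hp.
have fT := cofinite_idealS (fin 0%N) hT (@subsetT _ _).
elim: k => [|k IH].
  rewrite (_ : ideal_add _ _ = [set: R]) ?colength_setT //.
  apply: ideal_eqT; first exact: ideal_addP.
  by rewrite expr0; apply: ideal_addl => //; exact: principal_id.
have := colength_mul (p ^+ k) hT fT (fin k.+1).
rewrite colength_setT setTI addn0.
set Qk1 := ideal_add (principal (p ^+ k.+1)) _.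
have hQ : ideal Qk1 by exact: ideal_addP.
have -> : ideal_add (elt_mul (p ^+ k) [set: R]) Qk1 =
          ideal_add (principal (p ^+ k)) (principal q).
  apply/seteqP; split; apply: ideal_add_sub; try exact: ideal_addP.
  - exact: ideal_addl.
  - apply: ideal_add_sub; [exact: ideal_addP| |exact: ideal_addr].
    apply: (@subset_trans _ (principal (p ^+ k))); last exact: ideal_addl.
    by move=> _ [x _ <-]; exists (p * x) => //; rewrite exprSr mulrA.
  - exact: ideal_addl.
  - by apply: (@subset_trans _ Qk1); exact: ideal_addr.
have -> : colon Qk1 (p ^+ k) = ideal_add (principal p) (principal q).
  apply/seteqP; split.
    move=> x; rewrite /colon /= => -[_ [_ [[y _ <-] [z _ <-] e]]].
    have [|w [ew _]] := kos k (x - p * y) (- z).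
      by rewrite mulrBr e exprSr; ring.
    exists (p * y), (q * w); split; [by exists y|by exists w|].
    by rewrite -ew; ring.
  apply: ideal_add_sub; first exact: colonP.
    move=> _ [x _ <-]; rewrite /colon /=; apply: ideal_addl => //.
    by exists x => //; rewrite exprSr mulrA.
  by apply: (@subset_trans _ Qk1); [exact: ideal_addr|exact: colon_sub].
by move=> ->; rewrite IH mulSn addnC.
Qed.

Lemma colength_principal_pow p q k :
  (forall i j, koszul_exact (p ^+ i) (q ^+ j)) ->
  (forall i j,
     cofinite_ideal (ideal_add (principal (p ^+ i)) (principal (q ^+ j)))) ->
  colength (ideal_add (principal (p ^+ k)) (principal (q ^+ k))) =
  (k ^ 2 * colength (ideal_add (principal p) (principal q)))%N.
Proof.
move=> kos fin; rewrite colength_principal_powl //.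
rewrite ideal_addC colength_principal_powl.
- by rewrite ideal_addC mulnA.
- by move=> i; apply: koszul_exactC; exact: (kos 1%N).
- by move=> i; rewrite ideal_addC; exact: (fin 1%N).
Qed.

End Colength.

(** * Products and powers of ideals *)

Section Powers.
Variable R : comNzRingType.
Implicit Types (A B I J K L M N X Y m : set R) (a b c p q x y z : R).

Lemma ideal_mulP I J : ideal (ideal_mul I J).
Proof. exact: ideal_gen_ideal. Qed.

Lemma ideal_mul_in I J x y : I x -> J y -> ideal_mul I J (x * y).
Proof. by move=> Ix Jy; apply: ideal_gen_sub; exists x, y. Qed.

Lemma ideal_mul_min I J K : ideal K ->
  (forall x y, I x -> J y -> K (x * y)) -> ideal_mul I J `<=` K.
Proof.
by move=> hK h; apply: ideal_gen_min => // _ [x [y [Ix Jy ->]]]; exact: h.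
Qed.

Lemma ideal_mulC I J : ideal_mul I J = ideal_mul J I.
Proof.
apply/seteqP; split; apply: ideal_mul_min (@ideal_mulP _ _) _ => x y Ix Jy;
  rewrite mulrC; exact: ideal_mul_in.
Qed.

Lemma ideal_mulA I J K :
  ideal_mul I (ideal_mul J K) = ideal_mul (ideal_mul I J) K.
Proof.
have sub X Y Z : ideal_mul X (ideal_mul Y Z) `<=` ideal_mul (ideal_mul X Y) Z.
  apply: ideal_mul_min (@ideal_mulP _ _) _ => x y Xx.
  (* An element of [ideal_mul Y Z] is only a sum of products; passing to the colon ideal by [x]
     reduces the claim to single products. *)
  suff : ideal_mul Y Z `<=` colon (ideal_mul (ideal_mul X Y) Z) x by apply.
  apply: ideal_mul_min => [|u v Yu Zv]; first exact/colonP/ideal_mulP.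
  by rewrite /colon /= mulrA; do 2?apply: ideal_mul_in.
apply/seteqP; split; first exact: sub.
rewrite (ideal_mulC _ K) (ideal_mulC I (ideal_mul _ _)) (ideal_mulC I J).
by rewrite (ideal_mulC J K); exact: sub.
Qed.

Lemma ideal_mulTl J : ideal J -> ideal_mul [set: R] J = J.
Proof.
move=> hJ; apply/seteqP; split.
  by apply: ideal_mul_min => // x y _; exact: idealMl.
by move=> x Jx; rewrite -[x]mul1r; exact: ideal_mul_in.
Qed.

Lemma ideal_powP I n : ideal (ideal_pow I n).
Proof. by case: n => [|n]; [exact: idealT|exact: ideal_mulP]. Qed.

Lemma bipowP I J r s : ideal (bipow I J r s).
Proof. exact: ideal_mulP. Qed.

Lemma bipowC I J r s : bipow I J r s = bipow J I s r.
Proof. exact: ideal_mulC. Qed.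

Lemma bipow0l I J s : bipow I J 0 s = ideal_pow J s.
Proof. exact/ideal_mulTl/ideal_powP. Qed.

Lemma bipowSl I J r s : bipow I J r.+1 s = ideal_mul I (bipow I J r s).
Proof. by rewrite /bipow /= ideal_mulA. Qed.

Lemma ideal_pow_mul I J n : ideal_pow (ideal_mul I J) n = bipow I J n n.
Proof.
elim: n => [|n IH]; first by rewrite bipow0l.
by rewrite bipowSl bipowC bipowSl -[LHS]/(ideal_mul _ (ideal_pow _ n)) IH
  -ideal_mulA (bipowC J).
Qed.

Lemma bipow_powl I J a k r s x : I a -> bipow I J r s x ->
  bipow I J (r + k) s (a ^+ k * x).
Proof.
move=> Ia Px; elim: k => [|k IH]; first by rewrite addn0 mul1r.
by rewrite addnS bipowSl exprS -mulrA; exact: ideal_mul_in.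
Qed.

Lemma bipow_powr I J b k r s x : J b -> bipow I J r s x ->
  bipow I J r (s + k) (b ^+ k * x).
Proof. by move=> Jb; rewrite !(bipowC I); exact: bipow_powl. Qed.

Lemma radicalS A B : A `<=` B -> radical A `<=` radical B.
Proof. by move=> AB x [n Ax]; exists n; exact: AB. Qed.

Lemma radical_radical A : radical (radical A) `<=` radical A.
Proof. by move=> x [n [l Ax]]; exists (n * l)%N; rewrite exprM. Qed.

Lemma radical_ideal A : ideal A -> ideal (radical A).
Proof.
move=> hA; split=> [|x y [n Ax] [l Ay]|c x [n Ax]].
- by exists 1%N; exact: ideal0.
- exists (n + l)%N; rewrite exprDn.
  apply: (big_ind A) => [|u v|i _]; first exact: ideal0.
    exact: idealD.
  rewrite -mulr_natr; apply: idealMr => //.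
  (* In each binomial term either the exponent [n + l - i] of [x] is at least [n], or the exponent
     [i] of [y] is at least [l]. *)
  have [il|li] := leqP i l.
    have -> : (n + l - i = n + (l - i))%N by lia.
    by rewrite exprD -mulrA; exact: idealMr.
  have -> : (i = i - l + l :> nat)%N by lia.
  by rewrite exprD mulrA; exact: idealMl.
- by exists n; rewrite exprMn; exact: idealMl.
Qed.

Lemma radical_mul m I J : m `<=` radical I -> m `<=` radical J ->
  m `<=` radical (ideal_mul I J).
Proof.
move=> mI mJ x mx; have [n In] := mI x mx; have [l Jl] := mJ x mx.
by exists (n + l)%N; rewrite exprD; exact: ideal_mul_in.
Qed.

Lemma radical_bipow m I J r s : m `<=` radical I -> m `<=` radical J ->
  m `<=` radical (bipow I J r s).
Proof.
have pw K n : m `<=` radical K -> m `<=` radical (ideal_pow K n).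
  move=> mK; elim: n => [|n IH]; first by move=> x _; exists 0%N.
  exact: radical_mul.
by move=> mI mJ; apply: radical_mul; exact: pw.
Qed.

Lemma regular_expl x n : (forall z, x * z = 0 -> z = 0) ->
  forall z, x ^+ n * z = 0 -> z = 0.
Proof.
move=> h; elim: n => [|n IH] z; first by rewrite mul1r.
by rewrite exprS -mulrA => /h/IH.
Qed.

(** For one factor [y], induct on [n]: regularity modulo [x] gives [z = x u], and cancelling [x]
    leaves the same relation for [u] with a smaller power of [x]. The factors of [y ^+ l] are then
    removed one by one. *)
Lemma regular_exp x y n l : (forall z, x * z = 0 -> z = 0) ->
  (forall z, principal x (y * z) -> principal x z) ->
  forall z, principal (x ^+ n) (y ^+ l * z) -> principal (x ^+ n) z.
Proof.
move=> xreg yreg.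
have key : forall z, principal (x ^+ n) (y * z) -> principal (x ^+ n) z.
  elim: n => [|n IH] z [w _ e]; first by exists z; rewrite ?mul1r.
  have [u _ ez] : principal x z.
    by apply: yreg; exists (x ^+ n * w) => //; rewrite mulrA -exprS.
  have [v _ ev] : principal (x ^+ n) u.
    apply: IH; exists w => //; apply/eqP; rewrite -subr_eq0; apply/eqP/xreg.
    by rewrite mulrBr mulrA -exprS e -ez; ring.
  by exists v => //; rewrite exprS -mulrA ev.
elim: l => [|l IH] z; first by rewrite mul1r.
by rewrite exprSr -mulrA => /IH/key.
Qed.

(** The ideals generated by [[::]] and [[:: x]] are zero and [(x)], which makes the two regularity
    conditions elementary. *)
Lemma regular_sequence2 m (s : seq R) : regular_sequence_in m s -> size s = 2 ->
  exists x y, [/\ m x, m y, forall z, x * z = 0 -> z = 0 &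
    forall z, principal x (y * z) -> principal x z].
Proof.
case: s => [|x [|y []]] // [[_ reg] sm] _; exists x, y.
have gen0 : ideal_gen [set z | z \in [::]] = [set 0 : R].
  apply/seteqP; split; last first.
    by move=> _ ->; apply: ideal0; exact: ideal_gen_ideal.
  apply: ideal_gen_min => //; split=> // [u v -> ->|c u ->].
    by rewrite addr0.
  by rewrite mulr0.
have gen1 : ideal_gen [set z | z \in [:: x]] = principal x.
  apply/seteqP; split.
    apply: ideal_gen_min; first exact: principalP.
    by move=> z /=; rewrite inE => /eqP ->; exact: principal_id.
  move=> _ [z _ <-]; apply: (idealMr _ (ideal_gen_ideal _)).
  by apply: ideal_gen_sub; rewrite /= inE.
split.
- by apply: sm; rewrite inE eqxx.
- by apply: sm; rewrite !inE eqxx orbT.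
- by move=> z; have := reg 0%N isT z; rewrite /= gen0.
- by move=> z; have := reg 1%N isT z; rewrite /= gen1.
Qed.

(** If [a * z = 0], exactness applied to [(z, 0)] gives [z = b * w] with [a * w = 0]. Iterating, the
    ideals [(z_ i)] ascend; once they are stationary, [z_ n.+1] is a multiple of [b * z_ n.+1], and
    a Nakayama argument kills it. *)
Lemma koszul_regular m a b : noetherian R -> local_ring m -> m b ->
  koszul_exact a b -> forall z, a * z = 0 -> z = 0.
Proof.
move=> noeth lm mb kos.
have step z : a * z = 0 -> exists w, z = b * w /\ a * w = 0.
  move=> e; have [|w [-> e']] := kos z 0; first by rewrite e; ring.
  by exists w; split=> //; apply/eqP; rewrite -oppr_eq0 -e'.
have stepT (z : {z | a * z = 0}) :
    exists w : {w | a * w = 0}, sval z = b * sval w.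
  by case: z => z az; have [w [ez aw]] := step z az; exists (exist _ w aw).
have [f fP] := choice stepT => z az.
pose z_ i := sval (iter i f (exist _ z az)).
have zS i : z_ i = b * z_ i.+1 by rewrite /z_ /= -fP.
have [i|i|n /(_ n.+1 (leqnSn n)) e] :=
    @noetherian_chain R noeth (fun i => principal (z_ i)).
- exact: principalP.
- by move=> _ [w _ <-]; exists (b * w) => //; rewrite [in RHS]zS; ring.
have [c _ ec] : principal (z_ n) (z_ n.+1) by rewrite -e; exact: principal_id.
have u0 : (1 - b * c) * z_ n.+1 = 0.
  by rewrite mulrBl mul1r -[X in X - _]ec zS; ring.
(* [1 - b * c] is a unit: otherwise it would lie in [m] together with [b * c], forcing 1 into
   [m]. *)
have [u _ eu] : principal (1 - b * c) 1.
  apply: contrapT => n1.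
  have := proper_sub_maximal noeth lm (@principalP R _) n1 (principal_id _).
  have [mm _] := lm; have hm := let: And3 h _ _ := mm in h.
  move=> h; apply: (maximal1 mm); rewrite -(subrK (b * c) 1).
  by apply: idealD => //; exact: idealMr.
have z0 : z_ n.+1 = 0.
  by rewrite -[LHS]mul1r -eu mulrAC u0 mul0r.
have : forall i, (i <= n.+1)%N -> z_ (n.+1 - i)%N = 0.
  elim=> [|i IH] le; first by rewrite subn0.
  by rewrite zS -subSn // subSS IH ?mulr0 // ltnW.
by move=> /(_ n.+1 (leqnn _)); rewrite subnn.
Qed.

End Powers.

(** * Eventual statements as explicit thresholds *)

Lemma near_natP (P : nat -> Prop) :
  (\forall n \near \oo, P n) <-> exists N, forall n, (N <= n)%N -> P n.
Proof. by split=> [[N _ h]|[N h]]; exists N. Qed.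

Lemma near_nat2P (P : nat -> nat -> Prop) :
  (\forall r \near \oo & s \near \oo, P r s) <->
  exists N, forall r s, (N <= r)%N -> (N <= s)%N -> P r s.
Proof.
split=> [[[U V] /= [[N _ NU] [M _ MV]] h]|[N h]].
  exists (maxn N M) => r s; rewrite !geq_max => /andP[Nr _] /andP[_ Ms].
  by apply: (h (r, s)); split; [exact: NU|exact: MV].
exists ([set r | (N <= r)%N], [set s | (N <= s)%N]); first by split; exists N.
by move=> [r s] /= [Nr Ns]; exact: h.
Qed.

(** * Joint reductions *)

Section JointReduction.
Variables (R : comNzRingType) (m I J : set R).
Hypotheses (noethR : noetherian R) (lm : local_ring m).
Hypotheses (mI : m `<=` radical I) (mJ : m `<=` radical J).
Implicit Types (a b x y z : R) (k r s : nat).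

Lemma cofinite_radical K : ideal K -> m `<=` radical K -> cofinite_ideal K.
Proof. by move=> hK mK; case: lm => mm _; exact: finite_colength mm hK mK. Qed.

Lemma cofinite_bipow r s : cofinite_ideal (bipow I J r s).
Proof. by apply: cofinite_radical; [exact: bipowP|exact: radical_bipow]. Qed.

(** The terms of the union [Ftilde], with [k = 0] allowed so that they form an ascending chain
    indexed by [nat]. *)
Definition Ftilde_term a b k r s : set R :=
  colon (bipow I J (r + k) s) (a ^+ k) `&` colon (bipow I J r (s + k)) (b ^+ k).

Lemma Ftilde_term_ideal a b k r s : ideal (Ftilde_term a b k r s).
Proof. by apply: idealI; apply: colonP; exact: bipowP. Qed.

Section Pair.
Variables (a b : R).
Hypotheses (Ia : I a) (Jb : J b).

Lemma Ftilde_term_sub k r s : bipow I J r s `<=` Ftilde_term a b k r s.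
Proof. by move=> z Pz; split; [exact: bipow_powl|exact: bipow_powr]. Qed.

Lemma Ftilde_termS k r s : Ftilde_term a b k r s `<=` Ftilde_term a b k.+1 r s.
Proof.
move=> z [az bz]; rewrite /Ftilde_term /colon /= !addnS !exprS -!mulrA.
split; first by have := bipow_powl (k := 1) Ia az; rewrite addn1.
by have := bipow_powr (k := 1) Jb bz; rewrite addn1.
Qed.

Lemma Ftilde_term_mono k l r s :
  (k <= l)%N -> Ftilde_term a b k r s `<=` Ftilde_term a b l r s.
Proof.
move=> kl; rewrite -(subnKC kl); elim: (l - k)%N => [|d IH].
  by rewrite addn0.
by rewrite addnS; apply: (subset_trans IH); exact: Ftilde_termS.
Qed.

Lemma Ftilde_near r s :
  \forall k \near \oo, Ftilde_term a b k r s = Ftilde I J a b r s.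
Proof.
have [i|i|n hn] := @noetherian_chain R noethR (fun k => Ftilde_term a b k r s).
- exact: Ftilde_term_ideal.
- exact: Ftilde_termS.
(* The threshold is [n.+1] and not [n] because the union only contains terms with [k >= 1]. *)
apply/near_natP; exists n.+1 => k nk; apply/seteqP; split=> [z Fz|z [l _ Fz]].
  by exists k; rewrite /=; [lia|exact: Fz].
rewrite hn; last exact: ltnW.
rewrite -(hn (maxn n l) (leq_maxl _ _)).
by apply: Ftilde_term_mono Fz; exact: leq_maxr.
Qed.

Lemma Ftilde_sub r s : ideal (Ftilde I J a b r s) /\
  bipow I J r s `<=` Ftilde I J a b r s.
Proof.
have /near_natP[n hn] := Ftilde_near r s.
by rewrite -(hn n (leqnn n)); split;
  [exact: Ftilde_term_ideal|exact: Ftilde_term_sub].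
Qed.

Definition M1den k r s : set R :=
  ideal_add (elt_mul (a ^+ k) (bipow I J r (s + k)))
            (elt_mul (b ^+ k) (bipow I J (r + k) s)).

Lemma M1denP k r s : ideal (M1den k r s).
Proof. by apply: ideal_addP; apply: elt_mulP; exact: bipowP. Qed.

Lemma M1den_sub k r s : M1den k r s `<=` bipow I J (r + k) (s + k).
Proof.
apply: ideal_add_sub; first exact: bipowP.
  by move=> _ [z Pz <-]; exact: bipow_powl.
by move=> _ [z Pz <-]; exact: bipow_powr.
Qed.

Section Exact.
Variables (x y : R).
Hypotheses (mx : m x) (my : m y).
Hypothesis xreg : forall z, x * z = 0 -> z = 0.
Hypothesis yreg : forall z, principal x (y * z) -> principal x z.
Hypothesis mab : m `<=` radical (ideal_add (principal a) (principal b)).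

Let Q k l := ideal_add (principal (a ^+ k)) (principal (b ^+ l)).

Lemma radical_pow_principal k l : m `<=` radical (Q k l).
Proof.
have hQ : ideal (Q k l) by apply: ideal_addP; exact: principalP.
apply: (subset_trans mab); apply: (subset_trans _ (@radical_radical _ _)).
apply: radicalS; apply: ideal_add_sub; first exact: radical_ideal.
- move=> _ [z _ <-]; exists k; rewrite exprMn; apply: idealMr => //.
  by apply: ideal_addl; [exact: principalP|exact: principal_id].
- move=> _ [z _ <-]; exists l; rewrite exprMn; apply: idealMr => //.
  by apply: ideal_addr; [exact: principalP|exact: principal_id].
Qed.

Lemma cofinite_pow_principal k l : cofinite_ideal (Q k l).
Proof.
apply: cofinite_radical; last exact: radical_pow_principal.
by apply: ideal_addP; exact: principalP.
Qed.

(** Some powers of [x] and [y] lie in [(a ^+ k, b ^+ l)] and inherit regularity, so exactness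
    follows without showing that [a, b] is itself a regular sequence. *)
Lemma koszul_exact_pow k l : koszul_exact (a ^+ k) (b ^+ l).
Proof.
have [n Qx] := radical_pow_principal k l mx.
have [n' Qy] := radical_pow_principal k l my.
apply: koszul_exact_regular Qx Qy; first exact: regular_expl.
exact: regular_exp.
Qed.

Lemma cofinite_M1den k r s : cofinite_ideal (M1den k r s).
Proof.
apply: cofinite_radical => [|z mz]; first exact: M1denP.
have [n [_ [_ [[u _ <-] [v _ <-] ez]]]] := radical_pow_principal k k mz.
have [i Az] := radical_bipow r (s + k) mI mJ mz.
have [j Bz] := radical_bipow (r + k) s mI mJ mz.
(* The extra factors [z ^+ i] and [z ^+ j] push the cofactors of [a ^+ k] and [b ^+ k] into the
   required ideals. *)
exists (n + (i + j))%N; rewrite exprD ez exprD.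
exists (a ^+ k * (u * z ^+ j * z ^+ i)), (b ^+ k * (v * z ^+ i * z ^+ j)).
split; last by ring.
- by apply: elt_mul_id; exact: (idealMl _ (bipowP _ _ _ _)).
- by apply: elt_mul_id; exact: (idealMl _ (bipowP _ _ _ _)).
Qed.

Lemma finite_length_M1 k r s : finite_length (M1 I J a b k r s).
Proof.
exact: (cofinite_finite (cofinite_M1den k r s) (bipowP _ _ _ _)
          (@M1den_sub k r s)).
Qed.

Lemma len_M1 k r s :
  (len (M1 I J a b k r s) + colength (bipow I J (r + k) (s + k))
   + colength (Ftilde_term a b k r s) =
   k ^ 2 * colength (ideal_add (principal a) (principal b))
   + colength (bipow I J r (s + k)) + colength (bipow I J (r + k) s))%N.
Proof.
have fD := cofinite_M1den k r s.
have := colength_len fD (bipowP _ _ _ _) (@M1den_sub k r s).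
have := colength_koszul (@koszul_exact_pow k k) (cofinite_bipow r (s + k))
  (cofinite_bipow (r + k) s) fD.
rewrite (colength_principal_pow _ (@koszul_exact_pow) cofinite_pow_principal).
rewrite setIC -/(Ftilde_term a b k r s) -/(M1den k r s) /M1 -/(M1den k r s).
by move=> e1 e2; lia.
Qed.

Lemma colength_Ftilde r s :
  colength (bipow I J r s) =
  (colength (Ftilde I J a b r s)
   + len (Subquot (Ftilde I J a b r s) (bipow I J r s)))%N.
Proof.
have [hF FP] := Ftilde_sub r s.
by apply: colength_len => //; exact: cofinite_bipow.
Qed.

End Exact.
End Pair.

Section Reduction.
Variables (a b : R).
Hypothesis jr : joint_reduction I J a b.

Let Ia : I a. Proof. by case: jr. Qed.
Let Jb : J b. Proof. by case: jr. Qed.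

(** The joint reduction equality places [I^(N+1) J^(N+1)] inside [(a, b)], and its radical already
    contains [m]. *)
Lemma joint_reduction_radical :
  m `<=` radical (ideal_add (principal a) (principal b)).
Proof.
have [_ _ /near_nat2P[N hN]] := jr.
apply: (subset_trans (radical_bipow N.+1 N.+1 mI mJ)); apply: radicalS.
rewrite hN // => _ [_ [_ [[u _ <-] [v _ <-] ->]]].
by exists (a * u), (b * v); split=> //; [exists u|exists v].
Qed.

Lemma joint_reduction_pow : exists N, forall r s, (N <= r)%N -> (N <= s)%N ->
  forall i j, bipow I J (r + i) (s + j) `<=`
    ideal_add (elt_mul (a ^+ i) (bipow I J r (s + j)))
              (elt_mul (b ^+ j) (bipow I J (r + i) s)).
Proof.
have [_ _ /near_nat2P[N hN]] := jr; exists N => r s Nr Ns.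
have hid c i j : ideal (elt_mul c (bipow I J i j)).
  by apply: elt_mulP; exact: bipowP.
elim=> [|i IHi] j.
  rewrite addn0 => z Pz; apply: ideal_addl => //.
  by exists z; rewrite ?expr0 ?mul1r.
elim: j => [|j IHj].
  rewrite addn0 => z Pz; apply: ideal_addr => //.
  by exists z; rewrite ?expr0 ?mul1r.
(* One use of the joint reduction equality splits the product into an [a]-part, treated by the
   induction on [i] for every [j], and a [b]-part, treated by the induction on [j]. *)
rewrite !addnS hN; [|lia|lia].
apply: ideal_add_sub; first exact: ideal_addP.
- move=> _ [z Pz <-]; rewrite -addnS in Pz.
  have [_ [_ [[u Pu <-] [v Pv <-] ->]]] := IHi _ _ Pz.
  rewrite -addnS.
  exists (a ^+ i.+1 * u), (b ^+ j.+1 * (a * v)).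
  split; last by rewrite (exprS a); ring.
    by exists u.
  by exists (a * v) => //; have := bipow_powl (k := 1) Ia Pv; rewrite addn1.
- move=> _ [z Pz <-]; rewrite -addnS in Pz.
  have [_ [_ [[u Pu <-] [v Pv <-] ->]]] := IHj _ Pz.
  rewrite -[(r + i).+1]addnS.
  exists (a ^+ i.+1 * (b * u)), (b ^+ j.+1 * v).
  split; last by rewrite (exprS b); ring.
    by exists (b * u) => //; have := bipow_powr (k := 1) Jb Pu; rewrite addn1.
  by exists v.
Qed.

(** Take [i = j = k] in [joint_reduction_pow]. The threshold does not depend on [k], which allows
    [k] to grow with [r] and [s] fixed. *)
Lemma len_M1_eq0 : exists N, forall r s, (N <= r)%N -> (N <= s)%N ->
  forall k, len (M1 I J a b k r s) = 0%N.
Proof.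
have [N hN] := joint_reduction_pow; exists N => r s Nr Ns k.
have hid c i j : ideal (elt_mul c (bipow I J i j)).
  by apply: elt_mulP; exact: bipowP.
rewrite /M1 (_ : ideal_add _ _ = bipow I J (r + k) (s + k)).
  apply: has_lengthE; split; first by apply: chain_between0; exact: bipowP.
  move=> [|l] // [X [[Xid Xlt] /= X0 Xl]].
  have [le1 le2] := Xlt 0%N isT; exfalso; apply: le2; rewrite X0 -Xl.
  by have [_] := chain_bounds (conj Xid Xlt) (isT : (1 <= l.+1)%N).
by apply/seteqP; split; [exact: M1den_sub|exact: hN].
Qed.

End Reduction.

(** Each step rewrites [a * (a ^+ k * z)] as [a * w] by superficiality and cancels one factor [a].
    The threshold is uniform in [s] and [k]. *)
Lemma superficial_colonl a : (forall z, a * z = 0 -> z = 0) ->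
  rees_superficial_l I J a ->
  exists N, forall r, (N <= r)%N -> forall s k,
    colon (bipow I J (r + k) s) (a ^+ k) `<=` bipow I J r s.
Proof.
move=> areg [Ia /near_natP[N hN]]; exists N => r Nr s; elim=> [|k IH] z.
  by rewrite /colon /= addn0 mul1r.
rewrite /colon /= addnS exprS -mulrA => h; apply: IH.
have : (principal a `&` bipow I J (r + k).+1 s) (a * (a ^+ k * z)).
  by split=> //; exists (a ^+ k * z).
rewrite hN; last by lia.
move=> [w Pw e]; rewrite /colon /= (_ : a ^+ k * z = w) //.
by apply/eqP; rewrite -subr_eq0; apply/eqP/areg; rewrite mulrBr e subrr.
Qed.

End JointReduction.

(** * Hilbert polynomials *)

Section HilbertPolynomials.
Implicit Types (k n r s N : nat).

Lemma bin2S n : ('C(n.+2, 2))%:Z = ('C(n.+1, 2))%:Z + n.+1%:Z.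
Proof. by rewrite binS bin1 PoszD. Qed.

(** Three consecutive values suffice: the second difference is the leading coefficient, then the
    first difference and the value give the others. *)
Lemma quadratic_uniq (c2 c1 c0 d2 d1 d0 : int) N :
  (forall n, (N <= n)%N ->
     c2 * ('C(n.+1, 2))%:Z - c1 * n%:Z + c0 =
     d2 * ('C(n.+1, 2))%:Z - d1 * n%:Z + d0) ->
  [/\ c2 = d2, c1 = d1 & c0 = d0].
Proof.
move=> h; have h0 := h N (leqnn _).
have h1 := h N.+1 (leqnSn _); have h2 := h N.+2 ltac:(lia).
rewrite !bin2S in h1 h2.
move: (('C(N.+1, 2))%:Z) h0 h1 h2 => X h0 h1 h2.
have e2 : c2 = d2.
  move: h0 h1 h2; rewrite -[N.+2]addn2 -[N.+1]addn1 !PoszD => h0 h1 h2.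
  by lia.
subst d2.
have e1 : c1 = d1 by move: h0 h1; rewrite -[N.+1]addn1 !PoszD => h0 h1; lia.
by subst d1; split=> //; lia.
Qed.

Variables (L : nat -> nat -> int) (c00 c10 c01 c20 c11 c02 : int).
Hypothesis hL : exists N, forall r s, (N <= r)%N -> (N <= s)%N ->
  L r s = c00 - c10 * r%:Z - c01 * s%:Z + c20 * ('C(r.+1, 2))%:Z
          + c11 * r%:Z * s%:Z + c02 * ('C(s.+1, 2))%:Z.
Variables (e0 : int) (g1 g2 : nat -> int).
Hypothesis hrow : forall r, exists N, forall s, (N <= s)%N ->
  L r s = e0 * ('C(s.+1, 2))%:Z - g1 r * s%:Z + g2 r.

(** For fixed large [r] the bigraded polynomial is quadratic in [s], so its coefficients can be
    compared with those of the row. *)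
Lemma row_coefficients_large : exists N, forall r, (N <= r)%N ->
  [/\ e0 = c02, g1 r = c01 - c11 * r%:Z &
      g2 r = c00 - c10 * r%:Z + c20 * ('C(r.+1, 2))%:Z].
Proof.
have [N hN] := hL; exists N => r Nr; have [M hM] := hrow r.
apply: (@quadratic_uniq _ _ _ _ _ _ (maxn N M)) => s.
rewrite geq_max => /andP[Ns Ms].
by rewrite -hM // hN //; ring.
Qed.

Lemma row_coefficient0 : e0 = c02.
Proof. by have [N /(_ N (leqnn _)) []] := row_coefficients_large. Qed.

(* The bigraded polynomial provides one threshold in s for all large r. *)
Lemma row_uniform : exists N, forall r s, (N <= s)%N ->
  L r s = e0 * ('C(s.+1, 2))%:Z - g1 r * s%:Z + g2 r.
Proof.
have [N hN] := hL; have [N' hN'] := row_coefficients_large.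
have [f hf] := choice hrow.
(* Only finitely many rows lie below [maxn N N']; the maximum of their own thresholds serves them
   all. *)
exists (maxn N (\max_(i < maxn N N') f i)) => r s.
rewrite geq_max => /andP[Ns Ms].
have [rN|] := ltnP r (maxn N N').
  apply: hf; apply: leq_trans Ms.
  exact: (leq_bigmax (F := fun i : 'I_(maxn N N') => f i) (Ordinal rN)).
rewrite geq_max => /andP[Nr N'r].
by have [-> -> ->] := hN' r N'r; rewrite hN //; ring.
Qed.

(** After substituting the row polynomials, the [e0] and [g2] terms cancel and the linear ones leave
    [k (g1 (r + k) - g1 r)], which telescopes along steps of [k]. Keeping [L] and [M] abstract
    allows the roles of [I] and [J] to be exchanged. *)
Lemma M1_rows (M : nat -> nat -> int) k N0 :
  (forall r s, (N0 <= s)%N -> M r s + L (r + k)%N (s + k)%N + L r s =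
     k%:Z ^+ 2 * c11 + L r (s + k)%N + L (r + k)%N s) ->
  exists N, (forall r s, (N <= s)%N ->
      M r s = k%:Z ^+ 2 * c11 + k%:Z * (g1 (r + k)%N - g1 r)) /\
    ((1 <= k)%N -> forall r s, (N <= r)%N -> (N <= s)%N ->
      \sum_(i < r) M (i * k)%N s = k%:Z * (c01 - g1 0%N)).
Proof.
move=> hM; have [N1 h1] := row_uniform; have [N2 h2] := row_coefficients_large.
have key r s : (maxn N0 (maxn N1 N2) <= s)%N ->
    M r s = k%:Z ^+ 2 * c11 + k%:Z * (g1 (r + k)%N - g1 r).
  rewrite !geq_max => /and3P[s0 s1 _]; have := hM r s s0.
  rewrite !(h1 _ (s + k)%N) ?(leq_trans s1) ?leq_addr // !(h1 _ s) // !PoszD.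
  by move=> e; apply/eqP; rewrite -subr_eq0; move/eqP: e; rewrite -subr_eq0 =>
    /eqP <-; apply/eqP; ring.
exists (maxn N0 (maxn N1 N2)); split=> // k1 r s.
rewrite !geq_max => /and3P[_ _ r2] hs.
have sum n : \sum_(i < n) M (i * k)%N s =
    n%:Z * (k%:Z ^+ 2 * c11) + k%:Z * (g1 (n * k)%N - g1 0%N).
  elim: n => [|n IH]; first by rewrite big_ord0 !mul0n !mul0r; ring.
  rewrite big_ord_recr /= IH key; last by rewrite !geq_max.
  by rewrite mulSn (addnC k) -[n.+1]addn1 PoszD; ring.
(* Since [k >= 1], [r * k] is also past the threshold; the term [- c11 * (r * k)] of [g1] then
   cancels the accumulated [r * k ^ 2 * c11]. *)
rewrite sum; have [|_ -> _] := h2 (r * k)%N.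
  by apply: leq_trans r2 _; rewrite leq_pmulr.
by rewrite PoszM; ring.
Qed.

End HilbertPolynomials.

(** The truncated subtraction in [r + i - 1] is harmless: it can only truncate for [i = 0], where
    the binomial coefficient is 1 anyway. *)
Lemma bihilbertE (R : comNzRingType) (I J : set R) (e : nat -> nat -> int) :
  bihilbert_coefficients I J e ->
  exists N, forall r s, (N <= r)%N -> (N <= s)%N ->
    (colength (bipow I J r s))%:Z =
    e 0%N 0%N - e 1%N 0%N * r%:Z - e 0%N 1%N * s%:Z
    + e 2%N 0%N * ('C(r.+1, 2))%:Z + e 1%N 1%N * r%:Z * s%:Z
    + e 0%N 2%N * ('C(s.+1, 2))%:Z.
Proof.
move=> /near_nat2P[N hN]; exists N => r s Nr Ns; rewrite hN //.
under eq_bigr do rewrite big_mkcond.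
rewrite !big_ord_recl !big_ord0 /= /bump /= !addn0 !add1n !bin0 !addn1 !addn2.
by rewrite !subn1 /= !bin1; ring.
Qed.

(** * The mixed multiplicity as the colength of [(a, b)] *)

Section MixedMultiplicity.
Variables (R : comNzRingType) (m I J : set R).
Hypotheses (noethR : noetherian R) (lm : local_ring m).
Hypotheses (mI : m `<=` radical I) (mJ : m `<=` radical J).
Variables (x y a b : R).
Hypotheses (mx : m x) (my : m y).
Hypothesis xreg : forall z, x * z = 0 -> z = 0.
Hypothesis yreg : forall z, principal x (y * z) -> principal x z.
Hypothesis jr : joint_reduction I J a b.
Variable e : nat -> nat -> int.
Hypothesis he : bihilbert_coefficients I J e.

Let L r s : int := (colength (bipow I J r s))%:Z.
Let mab := joint_reduction_radical mI mJ jr.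
Let Ia : I a. Proof. by case: jr. Qed.
Let Jb : J b. Proof. by case: jr. Qed.

Lemma len_M1_joint k r s :
  (len (M1 I J a b k r s))%:Z + L (r + k)%N (s + k)%N
  + (colength (Ftilde_term I J a b k r s))%:Z =
  k%:Z ^+ 2 * (colength (ideal_add (principal a) (principal b)))%:Z
  + L r (s + k)%N + L (r + k)%N s.
Proof.
have := len_M1 noethR lm mI mJ Ia Jb mx my xreg yreg mab k r s.
rewrite /L; lia.
Qed.

(* For r, s large, M1 vanishes for every k, so k^2 (e11 - l(R/(a,b))) is the
   length of a quotient of a submodule of R/I^r J^s, which is bounded in k. *)
Lemma mixed_multiplicity :
  (colength (ideal_add (principal a) (principal b)))%:Z = e 1%N 1%N.
Proof.
have [N hN] := bihilbertE he.
have [N' hN'] := len_M1_eq0 jr.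
pose r := maxn N N'; have Nr : (N <= r)%N := leq_maxl _ _.
have N'r : (N' <= r)%N := leq_maxr _ _.
have key k : exists d : nat, (d <= colength (bipow I J r r))%N /\
    d%:Z = k%:Z ^+ 2 *
      (e 1%N 1%N - (colength (ideal_add (principal a) (principal b)))%:Z).
  have := len_M1_joint k r r; rewrite hN' // add0r /L => eq.
  have fP := cofinite_bipow noethR lm mI mJ r r.
  have := colength_len fP (Ftilde_term_ideal I J a b k r r)
    (@Ftilde_term_sub _ I J a b Ia Jb k r r).
  (* With the length of [M1] equal to zero, the bigraded polynomial evaluates the other colengths,
     and all that survives is [k ^ 2] times the difference. *)
  move=> eF; exists (len (Subquot (Ftilde_term I J a b k r r) (bipow I J r r))).
  split; first by rewrite eF leq_addl.
  have -> : (len (Subquot (Ftilde_term I J a b k r r) (bipow I J r r)))%:Z =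
    (colength (bipow I J r r))%:Z - (colength (Ftilde_term I J a b k r r))%:Z.
    by rewrite eF PoszD; ring.
  have -> : (colength (Ftilde_term I J a b k r r))%:Z =
    k%:Z ^+ 2 * (colength (ideal_add (principal a) (principal b)))%:Z +
    (colength (bipow I J r (r + k)))%:Z + (colength (bipow I J (r + k) r))%:Z -
    (colength (bipow I J (r + k) (r + k)))%:Z by rewrite -eq; ring.
  have Nrk : (N <= r + k)%N := leq_trans Nr (leq_addr _ _).
  by rewrite !hN // !PoszD; ring.
set c := (X in _ - X) in key.
(* For [k] one more than the bound, [k ^ 2] times a nonzero integer exceeds the bound in absolute
   value, so the difference is zero. *)
have [d [dle de]] := key (colength (bipow I J r r)).+1.
suff h : e 1%N 1%N - c = 0 by apply/eqP; rewrite eq_sym -subr_eq0 h.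
by move: (e 1%N 1%N - c) de => z; rewrite expr2; nia.
Qed.

End MixedMultiplicity.

(** * Lengths of [M1] for large [k], and along rows and columns for superficial pairs *)

Section PartB.
Variables (R : comNzRingType) (m I J : set R).
Hypotheses (noethR : noetherian R) (lm : local_ring m).
Hypotheses (Im : I `<=` m) (Jm : J `<=` m).
Hypotheses (mI : m `<=` radical I) (mJ : m `<=` radical J).
Variables (x y : R).
Hypotheses (mx : m x) (my : m y).
Hypothesis xreg : forall z, x * z = 0 -> z = 0.
Hypothesis yreg : forall z, principal x (y * z) -> principal x z.
Variables (e : nat -> nat -> int) (e0I e0J : int) (g1 g2 h1 h2 : nat -> int).
Hypothesis he : bihilbert_coefficients I J e.
Hypothesis hg : row_coefficients I J e0J g1 g2.
Hypothesis hh : col_coefficients I J e0I h1 h2.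

Let L r s : int := (colength (bipow I J r s))%:Z.

Lemma row_coefficients_nat r : exists N, forall s, (N <= s)%N ->
  L r s = e0J * ('C(s.+1, 2))%:Z - g1 r * s%:Z + g2 r.
Proof. exact/near_natP/hg. Qed.

Lemma col_coefficients_nat s : exists N, forall r, (N <= r)%N ->
  L r s = e0I * ('C(r.+1, 2))%:Z - h1 s * r%:Z + h2 s.
Proof. exact/near_natP/hh. Qed.

(** The expansion with [s] as the row index, in the shape required to apply the results on rows to
    columns. *)
Lemma bihilbert_sym : exists N, forall s r, (N <= s)%N -> (N <= r)%N ->
  L r s = e 0%N 0%N - e 0%N 1%N * s%:Z - e 1%N 0%N * r%:Z
          + e 0%N 2%N * ('C(s.+1, 2))%:Z + e 1%N 1%N * s%:Z * r%:Z
          + e 2%N 0%N * ('C(r.+1, 2))%:Z.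
Proof.
have [N hN] := bihilbertE he.
by exists N => s r Ns Nr; rewrite /L hN //; ring.
Qed.

Section Pair.
Variables (a b : R).
Hypothesis jr : joint_reduction I J a b.

Let mab := joint_reduction_radical mI mJ jr.

Lemma len_M1_mixed k r s :
  (len (M1 I J a b k r s))%:Z + L (r + k)%N (s + k)%N
  + (colength (Ftilde_term I J a b k r s))%:Z =
  k%:Z ^+ 2 * e 1%N 1%N + L r (s + k)%N + L (r + k)%N s.
Proof.
by rewrite (len_M1_joint noethR lm mI mJ mx my xreg yreg jr)
  (mixed_multiplicity noethR lm mI mJ mx my xreg yreg jr he).
Qed.

(** For large [k] the bigraded, row and column polynomials evaluate the colengths at
    [(r + k, s + k)], [(r, s + k)] and [(r + k, s)]. The quadratic terms in [k] cancel because the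
    leading row and column coefficients are [e 0 2] and [e 2 0]. *)
Lemma len_M1_large r s : \forall k \near \oo,
  (len (M1 I J a b k r s))%:Z =
  (e 0%N 1%N - g1 r - e 1%N 1%N * r%:Z
   + e 1%N 0%N - h1 s - e 1%N 1%N * s%:Z) * k%:Z
  - e 1%N 1%N * r%:Z * s%:Z
  + (e 0%N 1%N - g1 r) * s%:Z + (e 1%N 0%N - h1 s) * r%:Z
  - e 0%N 0%N + g2 r + h2 s
  - (colength (bipow I J r s))%:Z
  + (len (Subquot (Ftilde I J a b r s) (bipow I J r s)))%:Z.
Proof.
have [Ia Jb _] := jr.
have [N hN] := bihilbertE he.
have [N1 hN1] := row_coefficients_nat r; have [N2 hN2] := col_coefficients_nat s.
have /near_natP[N3 hN3] := Ftilde_near noethR Ia Jb r s.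
apply/near_natP; exists (N + N1 + N2 + N3)%N => k Nk.
have eF := colength_Ftilde noethR lm mI mJ Ia Jb r s.
have := len_M1_mixed k r s; rewrite hN3; last by lia.
rewrite eF PoszD /L hN; [|lia|lia].
rewrite -/(L _ _) hN1; last by lia.
rewrite -/(L (r + k)%N s) hN2; last by lia.
rewrite (row_coefficient0 (bihilbertE he) row_coefficients_nat).
rewrite (row_coefficient0 bihilbert_sym col_coefficients_nat) !PoszD => eq.
apply/eqP; rewrite -subr_eq0; move/eqP: eq; rewrite -subr_eq0 => /eqP <-.
by apply/eqP; ring.
Qed.

Hypotheses (sa : rees_superficial_l I J a) (sb : rees_superficial_r I J b).

(** For large [s] the colon by [b ^+ k] alone already cuts [Ftilde_term] down to [I^r J^s]. The case
    of [b] reduces to [superficial_colonl] by exchanging [I] and [J]. *)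
Lemma superficial_rows k : exists N, forall r s, (N <= s)%N ->
  (len (M1 I J a b k r s))%:Z + L (r + k)%N (s + k)%N + L r s =
  k%:Z ^+ 2 * e 1%N 1%N + L r (s + k)%N + L (r + k)%N s.
Proof.
have [Ia Jb _] := jr.
have breg : forall z, b * z = 0 -> z = 0.
  apply: (koszul_regular noethR lm (Im Ia)); apply: koszul_exactC.
  exact: (koszul_exact_pow mx my xreg yreg mab (k := 1) (l := 1)).
have sb' : rees_superficial_l J I b.
  have [_ /near_natP[N hN]] := sb; split=> //; apply/near_natP.
  by exists N => n Nn s; rewrite !(bipowC J) hN.
have [N hN] := superficial_colonl breg sb'.
exists N => r s Ns; rewrite -(len_M1_mixed k r s) /L.
rewrite (_ : Ftilde_term I J a b k r s = bipow I J r s) //.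
apply/seteqP; split; last exact: Ftilde_term_sub.
by move=> z [_]; rewrite !(bipowC I) => /hN; apply.
Qed.

Lemma superficial_cols k : exists N, forall s r, (N <= r)%N ->
  (len (M1 I J a b k r s))%:Z + L (r + k)%N (s + k)%N + L r s =
  k%:Z ^+ 2 * e 1%N 1%N + L (r + k)%N s + L r (s + k)%N.
Proof.
have [Ia Jb _] := jr.
have areg : forall z, a * z = 0 -> z = 0.
  apply: (koszul_regular noethR lm (Jm Jb)).
  exact: (koszul_exact_pow mx my xreg yreg mab (k := 1) (l := 1)).
have [N hN] := superficial_colonl areg sa.
exists N => s r Nr; rewrite [RHS]addrAC -(len_M1_mixed k r s) /L.
rewrite (_ : Ftilde_term I J a b k r s = bipow I J r s) //.
apply/seteqP; split; last exact: Ftilde_term_sub.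
by move=> z [/hN + _]; apply.
Qed.

Lemma M1_rows_superficial k : exists N, (forall r s, (N <= s)%N ->
    (len (M1 I J a b k r s))%:Z
    = k%:Z ^+ 2 * e 1%N 1%N + k%:Z * (g1 (r + k)%N - g1 r)) /\
  ((1 <= k)%N -> forall r s, (N <= r)%N -> (N <= s)%N ->
    \sum_(i < r) (len (M1 I J a b k (i * k) s))%:Z
    = k%:Z * (e 0%N 1%N - g1 0%N)).
Proof.
have [N hN] := superficial_rows k.
exact: (M1_rows (M := fun r s => (len (M1 I J a b k r s))%:Z)
  (bihilbertE he) row_coefficients_nat hN).
Qed.

(** This is [M1_rows] for the transposed families, with [s] as the row index. *)
Lemma M1_cols_superficial k : exists N, (forall s r, (N <= r)%N ->
    (len (M1 I J a b k r s))%:Z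
    = k%:Z ^+ 2 * e 1%N 1%N + k%:Z * (h1 (s + k)%N - h1 s)) /\
  ((1 <= k)%N -> forall s r, (N <= s)%N -> (N <= r)%N ->
    \sum_(i < s) (len (M1 I J a b k r (i * k)))%:Z
    = k%:Z * (e 1%N 0%N - h1 0%N)).
Proof.
have [N hN] := superficial_cols k.
exact: (M1_rows (L := fun s r => L r s)
  (M := fun s r => (len (M1 I J a b k r s))%:Z)
  bihilbert_sym col_coefficients_nat hN).
Qed.

End Pair.
End PartB.

Theorem proposition3p9 (R : comNzRingType) (m I J : set R) (a b : R)
    (eI eJ eIJ : nat -> int) (e : nat -> nat -> int)
    (g1 g2 h1 h2 : nat -> int)
    (hCM : cohen_macaulay_local m)
    (hdim : krull_dim_is R 2)
    (hinf : infinite_set (residue_field m))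
    (hI : is_primary_to m I)
    (hJ : is_primary_to m J)
    (hab : joint_reduction I J a b)
    (heI : hilbert_coefficients I eI)
    (heJ : hilbert_coefficients J eJ)
    (heIJ : hilbert_coefficients (ideal_mul I J) eIJ)
    (he : bihilbert_coefficients I J e)
    (hg : row_coefficients I J (eJ 0%N) g1 g2)
    (hh : col_coefficients I J (eI 0%N) h1 h2) :
  (* the lengths below are lengths of modules of finite length *)
  [/\ forall r s, finite_length (Subquot [set: R] (bipow I J r s)),
      forall r s,
        finite_length (Subquot (Ftilde I J a b r s) (bipow I J r s))
    & forall k r s, (1 <= k)%N -> finite_length (M1 I J a b k r s)]
  /\
  (* (a) *)
  (forall r s : nat,
    (\forall k \near \oo,
      (len (M1 I J a b k r s))%:Z
      = (e 0%N 1%N - g1 r - e 1%N 1%N * r%:Z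
         + e 1%N 0%N - h1 s - e 1%N 1%N * s%:Z) * k%:Z
        - e 1%N 1%N * r%:Z * s%:Z
        + (e 0%N 1%N - g1 r) * s%:Z + (e 1%N 0%N - h1 s) * r%:Z
        - eIJ 2%N + g2 r + h2 s
        - (colength (bipow I J r s))%:Z
        + (len (Subquot (Ftilde I J a b r s) (bipow I J r s)))%:Z)
    /\ exists2 p : {poly int}, (size p <= 2)%N &
         \forall k \near \oo, (len (M1 I J a b k r s))%:Z = p.[k%:Z])
  /\
  (rees_superficial_l I J a -> rees_superficial_r I J b ->
   forall k : nat, (1 <= k)%N ->
   (* (b) *)
   [/\ forall r : nat, \forall s \near \oo,
         (len (M1 I J a b k r s))%:Z
         = k%:Z ^+ 2 * e 1%N 1%N + k%:Z * (g1 (r + k)%N - g1 r),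
       forall s : nat, \forall r \near \oo,
         (len (M1 I J a b k r s))%:Z
         = k%:Z ^+ 2 * e 1%N 1%N + k%:Z * (h1 (s + k)%N - h1 s),
       forall r : nat, exists c : nat, forall a' b' : R,
         joint_reduction I J a' b' ->
         rees_superficial_l I J a' -> rees_superficial_r I J b' ->
         \forall s \near \oo, len (M1 I J a' b' k r s) = c
     & forall s : nat, exists c : nat, forall a' b' : R,
         joint_reduction I J a' b' ->
         rees_superficial_l I J a' -> rees_superficial_r I J b' ->
         \forall r \near \oo, len (M1 I J a' b' k r s) = c]
   /\
   (* (c) *)
   (\forall r \near \oo & s \near \oo,
      \sum_(i < r) (len (M1 I J a b k (i * k) s))%:Z
        = k%:Z * (e 0%N 1%N - eJ 1%N) /\
      \sum_(i < s) (len (M1 I J a b k r (i * k)))%:Z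
        = k%:Z * (e 1%N 0%N - eI 1%N))).
Proof.
have [noethR lm [d dimd [[s sreg sized] _]]] := hCM.
have d2 : d = 2.
  case: dimd => -[C hC] dmax; case: hdim => -[C' hC'] dmax'.
  by apply/eqP; rewrite eqn_leq (dmax' _ _ hC) (dmax _ _ hC').
have [x [y [mx my xreg yreg]]] := regular_sequence2 sreg (etrans sized d2).
have [_ eIm] := hI; have [_ eJm] := hJ.
have mI : m `<=` radical I by rewrite eIm.
have mJ : m `<=` radical J by rewrite eJm.
have Im : I `<=` m by rewrite -eIm => z Iz; exists 1%N.
have Jm : J `<=` m by rewrite -eJm => z Jz; exists 1%N.
have fP := cofinite_bipow noethR lm mI mJ.
have [Ia Jb _] := hab.
have mab := joint_reduction_radical mI mJ hab.
have e00 : eIJ 2 = e 0%N 0%N.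
  have [N hN] := bihilbertE he; have /near_natP[M hM] := heIJ.
  have [|_ _ //] := @quadratic_uniq (eIJ 0%N) (eIJ 1%N) (eIJ 2)
    (e 2%N 0%N + e 0%N 2%N + e 1%N 1%N *+ 2) (e 1%N 0%N + e 0%N 1%N + e 1%N 1%N)
    (e 0%N 0%N) (maxn N M).
  move=> n; rewrite geq_max => /andP[Nn Mn].
  rewrite -hM // ideal_pow_mul hN //.
  have : (n%:Z ^+ 2 = ('C(n.+1, 2))%:Z *+ 2 - n%:Z :> int).
    elim: n {Nn Mn} => [|n IH] //; rewrite bin2S.
    move: (('C(n.+1, 2))%:Z) IH => X IH.
    by rewrite -[n.+1]addn1 PoszD sqrrD IH; ring.
  by move=> en; rewrite -[_ * n%:Z * n%:Z]mulrA -expr2 en; ring.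
have eJ1 : g1 0%N = eJ 1%N.
  have [N hN] := row_coefficients_nat hg 0; have /near_natP[M hM] := heJ.
  have [|_ //] := @quadratic_uniq (eJ 0%N) (g1 0%N) (g2 0%N)
    (eJ 0%N) (eJ 1%N) (eJ 2) (maxn N M).
  move=> n; rewrite geq_max => /andP[Nn Mn].
  by rewrite -hM // -hN // bipow0l.
have eI1 : h1 0%N = eI 1%N.
  have [N hN] := col_coefficients_nat hh 0; have /near_natP[M hM] := heI.
  have [|_ //] := @quadratic_uniq (eI 0%N) (h1 0%N) (h2 0%N)
    (eI 0%N) (eI 1%N) (eI 2) (maxn N M).
  move=> n; rewrite geq_max => /andP[Nn Mn].
  by rewrite -hM // -hN // bipowC bipow0l.
split; [split=> [//|r t|k r t _]|split].
- have [hF FP] := Ftilde_sub noethR Ia Jb r t.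
  exact: cofinite_finite (fP r t) hF FP.
- exact: (finite_length_M1 noethR lm mI mJ Ia Jb mab).
- move=> r t.
  have large := len_M1_large noethR lm mI mJ mx my xreg yreg he hg hh hab r t.
  rewrite e00; split=> //.
  pose c1 := e 0%N 1%N - g1 r - e 1%N 1%N * r%:Z
    + e 1%N 0%N - h1 t - e 1%N 1%N * t%:Z.
  pose c0 := - e 1%N 1%N * r%:Z * t%:Z
    + (e 0%N 1%N - g1 r) * t%:Z + (e 1%N 0%N - h1 t) * r%:Z
    - e 0%N 0%N + g2 r + h2 t - (colength (bipow I J r t))%:Z
    + (len (Subquot (Ftilde I J a b r t) (bipow I J r t)))%:Z.
  exists (c1%:P * 'X + c0%:P).
    by rewrite size_MXaddC; case: ifP => // _; rewrite ltnS size_polyC leq_b1.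
  case/near_natP: large => N hN; apply/near_natP; exists N => k Nk.
  by rewrite hN // hornerMXaddC hornerC /c1 /c0; ring.
move=> sa sb k k1.
have rows a' b' := @M1_rows_superficial R m I J noethR lm Im mI mJ x y
  mx my xreg yreg e (eJ 0%N) g1 g2 he hg a' b'.
have cols a' b' := @M1_cols_superficial R m I J noethR lm Jm mI mJ x y
  mx my xreg yreg e (eI 0%N) h1 h2 he hh a' b'.
have [N [hr sr]] := rows _ _ hab sb k.
have [N' [hc sc]] := cols _ _ hab sa k.
split; first split.
- by move=> r; apply/near_natP; exists N => t; exact: hr.
- by move=> t; apply/near_natP; exists N' => r; exact: hc.
- move=> r; exists (absz (k%:Z ^+ 2 * e 1%N 1%N
                       + k%:Z * (g1 (r + k)%N - g1 r))%R).
  move=> a' b' jr _ sb'; have [M [hM _]] := rows _ _ jr sb' k.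
  by apply/near_natP; exists M => t Mt; rewrite -(hM r t Mt).
- move=> t; exists (absz (k%:Z ^+ 2 * e 1%N 1%N
                       + k%:Z * (h1 (t + k)%N - h1 t))%R).
  move=> a' b' jr sa' _; have [M [hM _]] := cols _ _ jr sa' k.
  by apply/near_natP; exists M => r Mr; rewrite -(hM t r Mr).
- apply/near_nat2P; exists (maxn N N') => r t.
  rewrite !geq_max => /andP[Nr N'r] /andP[Nt N't].
  by rewrite sr // sc // eJ1 eI1.
Qed.
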